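(* Let $n\ge2$ be even, and let $p\ge1$ be an integer with $p\equiv\pm1 \pmod{2(n+1)}$. Then $K_0(\mathcal C_{n,p}^A)=0$.
   Context: $K$ is an algebraically closed field, $A_n$ denotes the linearly oriented quiver $1\to 2\to\cdots\to n$, and $D^b(\operatorname{mod} KA_n)$ is the bounded derived category of finitely generated $KA_n$-modules, with shift functor $\Sigma$ and Auslander–Reiten translation $\tau$. For an integer $p\ge 1$, the repetitive cluster category of type $A_n$ is the orbit category $\mathcal C_{n,p}^A=D^b(\operatorname{mod} KA_n)/\langle(\tau^{-1}\Sigma)^p\rangle$: it has the same objects as $D^b(\operatorname{mod} KA_n)$ and morphism spaces $\bigoplus_{i\in\mathbb Z}\operatorname{Hom}(X,(\tau^{-1}\Sigma)^{pi}Y)$; it carries its natural triangulated structure, for which the projection functor $D^b(\operatorname{mod} KA_n)\to\mathcal C_{n,p}^A$ is a triangle functor. The Grothendieck group $K_0(\mathcal C)$ of a triangulated category $\mathcal C$ is the free abelian group on isomorphism classes $[X]$ of objects modulo $[X\oplus Y]-[X]-[Y]$ and $[X]-[Y]+[Z]$ for all distinguished triangles $X\to Y\to Z\to\Sigma X$. *)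

(* Defs.v *)
From HB Require Import structures.
From mathcomp Require Export all_boot all_order all_algebra.
From mathcomp Require Import generic_quotient ring_quotient.
From mathcomp Require Import boolp classical_sets cardinality fsbigop.
From mathcomp.multinomials Require Import freeg.
From mathcomp Require Import zify.

Set Implicit Arguments.
Unset Strict Implicit.
Unset Printing Implicit Defensive.

Import GRing.Theory.
Import Quotient.

Local Open Scope classical_set_scope.
Local Open Scope ring_scope.
Local Open Scope quotient_scope.

#[local] Obligation Tactic := idtac.

Reserved Notation "g \c f" (at level 40, left associativity).

Record linCat (K : fieldType) := LinCat {
  obj :> Type;
  hom : obj -> obj -> lmodType K;
  idm : forall X, hom X X;
  mcomp : forall X Y Z, hom Y Z -> hom X Y -> hom X Z;
  compA : forall X Y Z W (h : hom Z W) (g : hom Y Z) (f : hom X Y),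
    mcomp h (mcomp g f) = mcomp (mcomp h g) f;
  comp1m : forall X Y (f : hom X Y), mcomp (idm Y) f = f;
  compm1 : forall X Y (f : hom X Y), mcomp f (idm X) = f;
  compPl : forall X Y Z a (g g' : hom Y Z) (f : hom X Y),
    mcomp (a *: g + g') f = a *: mcomp g f + mcomp g' f;
  compPr : forall X Y Z a (g : hom Y Z) (f f' : hom X Y),
    mcomp g (a *: f + f') = a *: mcomp g f + mcomp g f'
}.
Arguments idm {K l} X.
Arguments mcomp {K l X Y Z} g f.
Notation "g \c f" := (mcomp g f) : ring_scope.

Section LinCatTheory.
Variables (K : fieldType) (C : linCat K).
Implicit Types X Y Z : C.

Lemma compDl X Y Z (g g' : hom Y Z) (f : hom X Y) :
  (g + g') \c f = g \c f + g' \c f.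
Proof. by have := compPl 1 g g' f; rewrite !scale1r. Qed.

Lemma compDr X Y Z (g : hom Y Z) (f f' : hom X Y) :
  g \c (f + f') = g \c f + g \c f'.
Proof. by have := compPr 1 g f f'; rewrite !scale1r. Qed.

Lemma comp0m X Y Z (f : hom X Y) : (0 : hom Y Z) \c f = 0.
Proof. by apply: (@addrI _ ((0 : hom Y Z) \c f)); rewrite -compDl !addr0. Qed.

Lemma compm0 X Y Z (g : hom Y Z) : g \c (0 : hom X Y) = 0.
Proof. by apply: (@addrI _ (g \c (0 : hom X Y))); rewrite -compDr !addr0. Qed.

Definition is_iso X Y (f : hom X Y) :=
  exists g : hom Y X, g \c f = idm X /\ f \c g = idm Y.

Definition is_zero_obj X := idm X = 0.

Definition is_biproduct X Y Z (i1 : hom X Z) (i2 : hom Y Z)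
    (p1 : hom Z X) (p2 : hom Z Y) :=
  [/\ p1 \c i1 = idm X, p2 \c i2 = idm Y, p2 \c i1 = 0, p1 \c i2 = 0
    & i1 \c p1 + i2 \c p2 = idm Z].

Definition additive_cat :=
  (exists Z : C, is_zero_obj Z) /\
  (forall X Y, exists (Z : C) (i1 : hom X Z) (i2 : hom Y Z)
     (p1 : hom Z X) (p2 : hom Z Y), is_biproduct i1 i2 p1 p2).

End LinCatTheory.

Record functor (K : fieldType) (C D : linCat K) := Functor {
  fobj :> C -> D;
  fmap : forall X Y : C, {linear hom X Y -> hom (fobj X) (fobj Y)};
  fmap1 : forall X, fmap X X (idm X) = idm (fobj X);
  fmapM : forall X Y Z (g : hom Y Z) (f : hom X Y),
    fmap X Z (g \c f) = fmap Y Z g \c fmap X Y f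
}.
Arguments fmap {K C D} _ {X Y}.

Record natiso (K : fieldType) (C D : linCat K) (F G : functor C D) := NatIso {
  nt :> forall X, hom (F X) (G X);
  nt_iso : forall X, is_iso (nt X);
  nt_nat : forall X Y (f : hom X Y), nt Y \c fmap F f = fmap G f \c nt X
}.

Section Functors.
Variable K : fieldType.

Program Definition fid (C : linCat K) : functor C C :=
  @Functor K C C id (fun X Y => GRing.Linear.clone _ _ _ _ (@idfun (hom X Y)) _)
    _ _.
Next Obligation. by []. Qed.
Next Obligation. by []. Qed.

Program Definition fcomp (C D E : linCat K) (G : functor D E) (F : functor C D)
    : functor C E :=
  @Functor K C E (fun X => G (F X))
    (fun X Y => GRing.Linear.clone _ _ _ _ (@fmap _ _ _ G _ _ \o @fmap _ _ _ F X Y) _)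
    _ _.
Next Obligation. by move=> C D E G F X /=; rewrite !fmap1. Qed.
Next Obligation. by move=> C D E G F X Y Z g f /=; rewrite !fmapM. Qed.

Definition fiter (C : linCat K) (m : nat) (F : functor C C) : functor C C :=
  iter m (fcomp F) (fid C).

Record autoequiv (C : linCat K) := AutoEquiv {
  ae :> functor C C;
  ae_inv : functor C C;
  ae_unit : natiso (fid C) (fcomp ae_inv ae);
  ae_counit : natiso (fcomp ae ae_inv) (fid C)
}.

End Functors.

Record tri_data (K : fieldType) (C : linCat K) := TriData {
  susp : functor C C;
  dist : forall X Y Z : C, hom X Y -> hom Y Z -> hom Z (susp X) -> Prop
}.
Arguments dist {K C} t {X Y Z}.

Record triangulated (K : fieldType) (C : linCat K) (t : tri_data C) : Prop := {
  tr_additive : additive_cat C;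
  tr_susp : exists S : autoequiv C, ae S = susp t;
  tr_iso : forall X Y Z X' Y' Z' (u : hom X Y) (v : hom Y Z)
      (w : hom Z (susp t X)) (u' : hom X' Y') (v' : hom Y' Z')
      (w' : hom Z' (susp t X')) (a : hom X X') (b : hom Y Y') (c : hom Z Z'),
    is_iso a -> is_iso b -> is_iso c ->
    u' \c a = b \c u -> v' \c b = c \c v -> w' \c c = fmap (susp t) a \c w ->
    dist t u v w -> dist t u' v' w';
  tr_id : forall X, exists2 Z : C, is_zero_obj Z &
    dist t (idm X) (0 : hom X Z) 0;
  tr_cone : forall X Y (u : hom X Y), exists Z (v : hom Y Z)
    (w : hom Z (susp t X)), dist t u v w;
  tr_rot : forall X Y Z (u : hom X Y) (v : hom Y Z) (w : hom Z (susp t X)),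
    dist t u v w <-> dist t v w (- fmap (susp t) u);
  tr_mor : forall X Y Z X' Y' Z' (u : hom X Y) (v : hom Y Z)
      (w : hom Z (susp t X)) (u' : hom X' Y') (v' : hom Y' Z')
      (w' : hom Z' (susp t X')) (a : hom X X') (b : hom Y Y'),
    dist t u v w -> dist t u' v' w' -> u' \c a = b \c u ->
    exists c : hom Z Z', v' \c b = c \c v /\ w' \c c = fmap (susp t) a \c w;
  tr_oct : forall X Y Z X' Y' Z' (u : hom X Y) (v : hom Y Z)
      (i : hom Y Z') (i' : hom Z' (susp t X))
      (j : hom Z X') (j' : hom X' (susp t Y))
      (k : hom Z Y') (k' : hom Y' (susp t X)),
    dist t u i i' -> dist t v j j' -> dist t (v \c u) k k' ->
    exists (f : hom Z' Y') (g : hom Y' X'),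
      [/\ dist t f g (fmap (susp t) i \c j'),
          f \c i = k \c v, k' \c f = i',
          g \c k = j & j' \c g = fmap (susp t) u \c k']
}.

Definition triangle_functor (K : fieldType) (C D : linCat K) (tC : tri_data C)
    (tD : tri_data D) (F : functor C D) : Prop :=
  exists phi : natiso (fcomp F (susp tC)) (fcomp (susp tD) F),
    forall X Y Z (u : hom X Y) (v : hom Y Z) (w : hom Z (susp tC X)),
      dist tC u v w -> dist tD (fmap F u) (fmap F v) (phi X \c fmap F w).

Section GrothendieckGroup.
Variables (K : fieldType) (C : linCat K) (t : tri_data C).

Definition FreeOb := {freeg {classic C} / int}.
Definition cls (X : C) : FreeOb := << (X : {classic C}) >>.

(* The first family of relators turns the free abelian group on objects into *)
(* the free abelian group on isomorphism classes of objects.                 *)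
Inductive K0_relator : FreeOb -> Prop :=
| K0_rel_iso X Y (f : hom X Y) : is_iso f -> K0_relator (cls X - cls Y)
| K0_rel_sum X Y Z (i1 : hom X Z) (i2 : hom Y Z) (p1 : hom Z X) (p2 : hom Z Y) :
    is_biproduct i1 i2 p1 p2 -> K0_relator (cls Z - cls X - cls Y)
| K0_rel_tri X Y Z (u : hom X Y) (v : hom Y Z) (w : hom Z (susp t X)) :
    dist t u v w -> K0_relator (cls X - cls Y + cls Z).

Inductive K0_span : FreeOb -> Prop :=
| K0_span_rel x : K0_relator x -> K0_span x
| K0_span0 : K0_span 0
| K0_spanB x y : K0_span x -> K0_span y -> K0_span (x - y).

Definition K0_sub : {pred FreeOb} := fun x => `[< K0_span x >].

Fact K0_sub_zmod_closed : zmod_closed K0_sub.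
Proof.
split; first exact/asboolP/K0_span0.
by move=> x y /asboolP hx /asboolP hy; apply/asboolP/K0_spanB.
Qed.
HB.instance Definition _ :=
  GRing.isZmodClosed.Build FreeOb K0_sub K0_sub_zmod_closed.

Definition K0 : zmodType := {quot K0_sub}.

End GrothendieckGroup.

(* tau is an exact autoequivalence such that susp \o tau is a Serre functor: *)
(* [serre] is a natural pairing identifying hom Y (susp (tau X)) with the    *)
(* linear dual of hom X Y.  By Yoneda, tau is unique up to isomorphism.      *)
Record ar_translation (K : fieldType) (C : linCat K) (t : tri_data C) :=
  ARTranslation {
  tau :> autoequiv C;
  tau_exact : triangle_functor t t tau;
  serre : forall X Y : C, hom X Y -> hom Y (susp t (tau X)) -> K;
  serre_linl : forall X Y a (f f' : hom X Y) (g : hom Y (susp t (tau X))),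
    serre (a *: f + f') g = a * serre f g + serre f' g;
  serre_linr : forall X Y a (f : hom X Y) (g g' : hom Y (susp t (tau X))),
    serre f (a *: g + g') = a * serre f g + serre f g';
  serre_natr : forall X Y Y' (f : hom X Y) (b : hom Y Y')
      (g : hom Y' (susp t (tau X))), serre (b \c f) g = serre f (g \c b);
  serre_natl : forall X X' Y (f : hom X Y) (a : hom X' X)
      (g : hom Y (susp t (tau X'))),
    serre (f \c a) g = serre f (fmap (susp t) (fmap tau a) \c g);
  serre_perfect : forall X Y (phi : {linear hom X Y -> K^o}),
    exists! g : hom Y (susp t (tau X)), forall f, serre f g = phi f
}.

(* A coherent system of integer powers (F^i), i : int, of the endofunctor F, *)
(* i.e. a monoidal functor from the discrete group of integers to            *)
(* endofunctors of C, with F^1 isomorphic to F.  The argument [i + j = k] of *)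
(* [pw_mu] spares transports along equalities of integers.  Every            *)
(* autoequivalence has such a system, unique up to isomorphism.              *)
Record zpowers (K : fieldType) (C : linCat K) (F : functor C C) := ZPowers {
  pw :> int -> functor C C;
  pw_one : natiso (pw 1) F;
  pw_eta : natiso (fid C) (pw 0);
  pw_mu : forall i j k, i + j = k -> natiso (fcomp (pw i) (pw j)) (pw k);
  pw_etal : forall i X (h : 0 + i = i),
    pw_mu h X \c pw_eta (pw i X) = idm (pw i X);
  pw_etar : forall i X (h : i + 0 = i),
    pw_mu h X \c fmap (pw i) (pw_eta X) = idm (pw i X);
  pw_assoc : forall i j k ij jk ijk (h1 : i + j = ij) (h2 : ij + k = ijk)
      (h3 : j + k = jk) (h4 : i + jk = ijk) X,
    pw_mu h2 X \c pw_mu h1 (pw k X) = pw_mu h4 X \c fmap (pw i) (pw_mu h3 X)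
}.

Section DirectSum.
Variables (K : fieldType) (V : int -> lmodType K).

Record dirsum := DirSum {
  dsval :> forall i, V i;
  dsvalP : finite_set [set i | dsval i != 0]
}.

Lemma dirsum_eq (f g : dirsum) : (forall i, f i = g i) -> f = g.
Proof.
case: f g => [f hf] [g hg] /= e.
have {}e : f = g by apply: functional_extensionality_dep.
by subst g; congr DirSum; exact: Prop_irrelevance.
Qed.

HB.instance Definition _ := gen_eqMixin dirsum.
HB.instance Definition _ := gen_choiceMixin dirsum.

Program Definition ds_zero := @DirSum (fun=> 0) _.
Next Obligation.
by apply: (@sub_finite_set _ _ set0) => // i /=; rewrite eqxx.
Qed.

Program Definition ds_add (f g : dirsum) := @DirSum (fun i => f i + g i) _.
Next Obligation.
move=> f g; apply: (@sub_finite_set _ _ ([set i | f i != 0] `|` [set i | g i != 0])).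
  move=> i /=; case: (f i =P 0) => [->|/eqP]; last by left.
  by rewrite add0r; right.
by rewrite finite_setU; split; exact: dsvalP.
Qed.

Program Definition ds_scale (a : K) (f : dirsum) :=
  @DirSum (fun i => a *: f i) _.
Next Obligation.
move=> a f; apply: (sub_finite_set _ (dsvalP f)) => i /=.
by apply: contra => /eqP ->; rewrite scaler0.
Qed.

Fact ds_addA : associative ds_add.
Proof. by move=> f g h; apply: dirsum_eq => i /=; rewrite addrA. Qed.
Fact ds_addC : commutative ds_add.
Proof. by move=> f g; apply: dirsum_eq => i /=; rewrite addrC. Qed.
Fact ds_add0 : left_id ds_zero ds_add.
Proof. by move=> f; apply: dirsum_eq => i /=; rewrite add0r. Qed.
Fact ds_addN : left_inverse ds_zero (ds_scale (-1)) ds_add.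
Proof. by move=> f; apply: dirsum_eq => i /=; rewrite scaleN1r addNr. Qed.
HB.instance Definition _ :=
  GRing.isZmodule.Build dirsum ds_addA ds_addC ds_add0 ds_addN.

Fact ds_scaleA a b f : ds_scale a (ds_scale b f) = ds_scale (a * b) f.
Proof. by apply: dirsum_eq => i /=; rewrite scalerA. Qed.
Fact ds_scale1 : left_id 1 ds_scale.
Proof. by move=> f; apply: dirsum_eq => i /=; rewrite scale1r. Qed.
Fact ds_scaleDr : right_distributive ds_scale +%R.
Proof. by move=> a f g; apply: dirsum_eq => i /=; rewrite scalerDr. Qed.
Fact ds_scaleDl f : {morph ds_scale^~ f : a b / a + b}.
Proof. by move=> a b; apply: dirsum_eq => i /=; rewrite scalerDl. Qed.
HB.instance Definition _ :=
  GRing.Zmodule_isLmodule.Build K dirsum ds_scaleA ds_scale1 ds_scaleDr ds_scaleDl.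

End DirectSum.

Section FiniteSums.
Variable K : fieldType.

Lemma fsum_seq (V : zmodType) (F : int -> V) (s : seq int) :
  uniq s -> (forall i, i \notin s -> F i = 0) ->
  \sum_(i \in setT) F i = \sum_(i <- s) F i.
Proof.
move=> us hF; rewrite (fsbig_seq _ _ us); apply/esym/fsbig_widen => //.
by move=> i /= [_ /negP hi]; exact: hF.
Qed.

Lemma finite_int_seq (A : set int) : finite_set A ->
  exists2 s : seq int, uniq s & forall i, A i -> i \in s.
Proof.
move=> /finite_seqP [s ->]; exists (undup s) => [|i]; first exact: undup_uniq.
by rewrite mem_undup.
Qed.

Lemma fsum_linear (V W : lmodType K) (phi : V -> W) (F : int -> V) :
  (forall a u v, phi (a *: u + v) = a *: phi u + phi v) ->
  finite_set [set i | F i != 0] ->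
  phi (\sum_(i \in setT) F i) = \sum_(i \in setT) phi (F i).
Proof.
move=> hphi /finite_int_seq [s us hs].
have phiD u v : phi (u + v) = phi u + phi v.
  by have := hphi 1 u v; rewrite !scale1r.
have phi0 : phi 0 = 0.
  by apply: (@addrI _ (phi 0)); rewrite -phiD !addr0.
have F0 i : i \notin s -> F i = 0.
  by move=> his; apply/eqP; apply: contraNT his => /hs.
rewrite (fsum_seq us F0) (@fsum_seq _ _ s) //; last by move=> i /F0 ->.
by elim: s {us hs F0} => [|i s IH]; rewrite ?big_nil // !big_cons phiD IH.
Qed.

Lemma fsum_exchange (V : zmodType) (F : int -> int -> V) (s t : seq int) :
  uniq s -> uniq t ->
  (forall i j, i \notin s -> F i j = 0) ->
  (forall i j, j \notin t -> F i j = 0) ->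
  \sum_(i \in setT) \sum_(j \in setT) F i j =
  \sum_(j \in setT) \sum_(i \in setT) F i j.
Proof.
move=> us ut hs ht.
have e1 i : \sum_(j \in setT) F i j = \sum_(j <- t) F i j.
  by apply: fsum_seq => // j; exact: ht.
have e2 j : \sum_(i \in setT) F i j = \sum_(i <- s) F i j.
  by apply: fsum_seq => // i; exact: hs.
rewrite (fsum_seq us) => [|i his]; last first.
  by rewrite e1 big1 // => j _; exact: hs.
rewrite (fsum_seq ut) => [|j hjt]; last first.
  by rewrite e2 big1 // => i _; exact: ht.
by under eq_bigr do rewrite e1; rewrite exchange_big /=; under eq_bigr do rewrite -e2.
Qed.

End FiniteSums.

Section OrbitCategory.
Variables (K : fieldType) (C : linCat K) (F : functor C C) (T : zpowers F).

Definition ohom (X Y : C) : lmodType K := dirsum (fun i => hom X (T i Y)).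

Definition oterm (X Y Z : C) (g : ohom Y Z) (f : ohom X Y) (k i : int) :
    hom X (T k Z) :=
  pw_mu T (subrKC i k) Z \c fmap (T i) (g (k - i)) \c f i.

Lemma oterm_neq0 X Y Z (g : ohom Y Z) (f : ohom X Y) k i :
  oterm g f k i != 0 -> f i != 0 /\ g (k - i) != 0.
Proof.
rewrite /oterm => h; split; apply: contraNneq h => ->.
  by rewrite compm0.
by rewrite linear0 compm0 comp0m.
Qed.

Lemma oterm_fin X Y Z (g : ohom Y Z) (f : ohom X Y) k :
  finite_set [set i | oterm g f k i != 0].
Proof. by apply: (sub_finite_set _ (dsvalP f)) => i /= /oterm_neq0 []. Qed.

(* (g o f)_k is the sum over i + j = k of F^i(g_j) o f_i. *)
Program Definition ocomp (X Y Z : C) (g : ohom Y Z) (f : ohom X Y) : ohom X Z :=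
  @DirSum K _ (fun k => \sum_(i \in setT) oterm g f k i) _.
Next Obligation.
move=> X Y Z g f.
apply: (@sub_finite_set _ _
  ((fun ij : int * int => ij.1 + ij.2) @`
     ([set i | f i != 0] `*` [set j | g j != 0]))); last first.
  by apply: finite_image; apply: finite_setX; exact: dsvalP.
move=> k /= /eqP hk; apply: contrapT => hn; apply: hk.
apply: fsbig1 => i _; apply/eqP; apply: contraT => /oterm_neq0 [hf hg].
by case: hn; exists (i, k - i) => //=; rewrite subrKC.
Qed.

(* A morphism of C placed in degree 0. *)
Definition oinj_fun (X Y : C) (f : hom X Y) (k : int) : hom X (T k Y) :=
  match k =P 0 with
  | ReflectT e => eq_rect_r (fun k => hom X (T k Y)) (pw_eta T Y \c f) e
  | ReflectF _ => 0
  end.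

Lemma oinj_fun0 X Y (f : hom X Y) : oinj_fun f 0 = pw_eta T Y \c f.
Proof. by rewrite /oinj_fun; case: eqP => // e; rewrite (eq_axiomK e). Qed.

Lemma oinj_funN0 X Y (f : hom X Y) k : k != 0 -> oinj_fun f k = 0.
Proof. by rewrite /oinj_fun; case: eqP. Qed.

Program Definition oinj (X Y : C) (f : hom X Y) : ohom X Y :=
  @DirSum K _ (oinj_fun f) _.
Next Obligation.
move=> X Y f; apply: (@sub_finite_set _ _ [set 0]); last exact: finite_set1.
by move=> k /=; have [//|/oinj_funN0 ->] := eqVneq k 0; rewrite eqxx.
Qed.

Lemma oinj_linear X Y a (f g : hom X Y) :
  oinj (a *: f + g) = a *: oinj f + oinj g.
Proof.
apply: dirsum_eq => k /=; have [->|k0] := eqVneq k 0.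
  by rewrite !oinj_fun0 compPr.
by rewrite !oinj_funN0 // scaler0 addr0.
Qed.

Lemma ocomp_single X Y Z (g : ohom Y Z) (f : ohom X Y) k i :
  (forall j, j != i -> oterm g f k j = 0) -> ocomp g f k = oterm g f k i.
Proof.
move=> h; rewrite /= (@fsum_seq _ _ [:: i]) ?big_seq1 // => j.
by rewrite inE; exact: h.
Qed.

Lemma ocomp1m X Y (f : ohom X Y) : ocomp (oinj (idm Y)) f = f.
Proof.
apply: dirsum_eq => k; rewrite (@ocomp_single _ _ _ _ _ _ k) => [|j jk].
  rewrite /oterm; move: (subrKC k k) => e; rewrite /=.
  move: e; rewrite subrr => e.
  by rewrite oinj_fun0 compm1 pw_etar comp1m.
by rewrite /oterm /= oinj_funN0 ?linear0 ?compm0 ?comp0m // subr_eq0 eq_sym.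
Qed.

Lemma ocompm1 X Y (f : ohom X Y) : ocomp f (oinj (idm X)) = f.
Proof.
apply: dirsum_eq => k; rewrite (@ocomp_single _ _ _ _ _ _ 0) => [|j j0].
  rewrite /oterm /= oinj_fun0 compm1; move: (subrKC 0 k); rewrite subr0 => e.
  by rewrite -compA -(nt_nat (pw_eta T)) compA pw_etal comp1m.
by rewrite /oterm /= oinj_funN0 ?compm0.
Qed.

Lemma pw_assoc_terms i j l a b m X Y Z W (f : hom X (T i Y)) (g : hom Y (T j Z))
    (h : hom Z (T l W)) (e1 : i + j = a) (e2 : a + l = m) (e3 : j + l = b)
    (e4 : i + b = m) :
  pw_mu T e2 W \c fmap (T a) h \c (pw_mu T e1 Z \c fmap (T i) g \c f) =
  pw_mu T e4 W \c fmap (T i) (pw_mu T e3 W \c fmap (T j) h \c g) \c f.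
Proof.
rewrite !fmapM !compA; congr (_ \c _ \c _).
rewrite -(pw_assoc T e1 e2 e3 e4) -!compA; congr (_ \c _).
exact: (esym (nt_nat (pw_mu T e1) h)).
Qed.

Lemma ocompA X Y Z W (h : ohom Z W) (g : ohom Y Z) (f : ohom X Y) :
  ocomp h (ocomp g f) = ocomp (ocomp h g) f.
Proof.
apply: dirsum_eq => m /=.
pose A i k := pw_mu T (subrKC k m) W \c fmap (T k) (h (m - k)) \c oterm g f k i.
pose B i j := pw_mu T (subrKC i m) W \c fmap (T i) (oterm h g (m - i) j) \c f i.
have [s us hs] := finite_int_seq (dsvalP f).
have [t' ut' ht'] := finite_int_seq (dsvalP g).
transitivity (\sum_(k \in setT) \sum_(i \in setT) A i k).
  apply: eq_fsbigr => k _.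
  rewrite /oterm /= (fsum_linear _ (oterm_fin g f k)) // => a u v.
  by rewrite compPr.
have A0 i k : A i k != 0 -> f i != 0 /\ g (k - i) != 0.
  by move=> hA; apply: oterm_neq0; apply: contraNneq hA; rewrite /A => ->; rewrite compm0.
pose r := undup [seq i + j | i <- s, j <- t'].
rewrite (@fsum_exchange _ _ r s) ?undup_uniq //; first last.
- move=> k i his; apply/eqP; apply: contraNT his => /A0 [hf _]; exact: hs.
- move=> k i; apply: contraNeq => /A0 [/hs hf /ht' hg]; rewrite mem_undup.
  by apply/allpairsP; exists (i, k - i); rewrite /= subrKC.
apply: eq_fsbigr => i _.
transitivity (\sum_(j \in setT) B i j); last first.
  pose P j := oterm h g (m - i) j.
  have finP (V : zmodType) (phi : forall j, hom Y (T (m - i) W) -> V) :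
      (forall j, phi j 0 = 0) -> finite_set [set j | phi j (P j) != 0].
    move=> phi0; apply: (sub_finite_set _ (oterm_fin h g (m - i))) => j /=.
    by apply: contraNneq => e; rewrite /P e phi0.
  symmetry; rewrite {1}/oterm.
  rewrite (fsum_linear (phi := fmap (T i)) _ (oterm_fin h g (m - i)));
    last by move=> a u v; rewrite linearP.
  rewrite (fsum_linear (phi := fun u => pw_mu T (subrKC i m) W \c u)).
  - rewrite (fsum_linear (phi := fun u => u \c f i)) //.
      by move=> a u v; rewrite compPl.
    apply: (finP _ (fun j u => pw_mu T (subrKC i m) W \c fmap (T i) u)) => j.
    by rewrite linear0 compm0.
  - by move=> a u v; rewrite compPr.
  - by apply: (finP _ (fun j u => fmap (T i) u)) => j; rewrite linear0.
rewrite (@reindex_fsbigT _ _ _ _ _ (fun j => i + j)); last first.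
  by exists (fun k => k - i) => j; [rewrite addrC addKr | rewrite subrKC].
apply: eq_fsbigr => j _; rewrite /A /B /oterm.
move: (subrKC (i + j) m) (subrKC i (i + j)) (subrKC j (m - i)) (subrKC i m).
rewrite [i + j - i]addrC addKr opprD [m + (- i - j)]addrA => e2 e1 e3 e4.
exact: pw_assoc_terms.
Qed.

Fact ocompPl X Y Z a (g g' : ohom Y Z) (f : ohom X Y) :
  ocomp (a *: g + g') f = a *: ocomp g f + ocomp g' f.
Proof.
apply: dirsum_eq => k /=.
have [s us hs] := finite_int_seq (dsvalP f).
have F0 g0 i : i \notin s -> oterm g0 f k i = 0.
  by apply: contraNeq => /oterm_neq0 [] /hs.
rewrite !(fsum_seq us) //; try exact: F0.
rewrite scaler_sumr -big_split /=; apply: eq_bigr => i _.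
by rewrite /oterm /= linearP compPr compPl.
Qed.

Fact ocompPr X Y Z a (g : ohom Y Z) (f f' : ohom X Y) :
  ocomp g (a *: f + f') = a *: ocomp g f + ocomp g f'.
Proof.
apply: dirsum_eq => k /=.
have [s us hs] := finite_int_seq (dsvalP f).
have [s' us' hs'] := finite_int_seq (dsvalP f').
have [r ur hr] : exists2 r : seq int, uniq r & forall i, i \notin r -> f i = 0 /\ f' i = 0.
  exists (undup (s ++ s')) => [|i]; first exact: undup_uniq.
  rewrite mem_undup mem_cat negb_or => /andP[h h'].
  by split; apply/eqP; [apply: contraNT h => /hs | apply: contraNT h' => /hs'].
have F0 (f0 : ohom X Y) i : f0 i = 0 -> oterm g f0 k i = 0 by rewrite /oterm => ->; rewrite compm0.
rewrite !(fsum_seq ur).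
- rewrite scaler_sumr -big_split /=; apply: eq_bigr => i _.
  by rewrite /oterm /= compPr.
- by move=> i /hr [_ h]; apply: F0.
- by move=> i /hr [h _]; apply: F0.
- by move=> i /hr [h h']; apply: F0; rewrite /= h h' scaler0 addr0.
Qed.

Definition orbit_cat : linCat K :=
  @LinCat K C ohom (fun X => oinj (idm X)) ocomp ocompA ocomp1m ocompm1
    ocompPl ocompPr.

Fact oinjM X Y Z (g : hom Y Z) (f : hom X Y) :
  oinj (g \c f) = ocomp (oinj g) (oinj f).
Proof.
apply: dirsum_eq => k; symmetry.
rewrite (@ocomp_single _ _ _ _ _ _ 0) => [|j j0]; last first.
  by rewrite /oterm /= (oinj_funN0 f j0) compm0.
rewrite /oterm /= (oinj_fun0 f); move: (subrKC 0 k); rewrite subr0 => e.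
rewrite -compA (compA (fmap (T 0) _)) -(nt_nat (pw_eta T)) -compA /=.
have [ek|k0] := eqVneq k 0; last first.
  by rewrite !oinj_funN0 // comp0m !compm0.
by move: e; rewrite ek => e; rewrite !oinj_fun0 compA pw_etal comp1m compA.
Qed.

HB.instance Definition _ X Y :=
  GRing.isLinear.Build K (hom X Y) (ohom X Y) _ (@oinj X Y) (@oinj_linear X Y).

Definition orbit_proj : functor C orbit_cat :=
  @Functor K C orbit_cat id (fun X Y => @oinj X Y) (fun=> erefl) oinjM.

End OrbitCategory.

(* Finitely generated K A_n-modules, as finite-dimensional representations   *)
(* of the quiver 0 -> 1 -> ... -> n-1 on the coordinate spaces of row        *)
(* vectors 'rV[K]_(rdim i).  Matrices act on the right, so the composite     *)
(* "first A, then B" is A *m B.                                              *)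

Section Representations.
Variables (K : fieldType) (n : nat).

Record rep := Rep {
  rdim :> 'I_n -> nat;
  rmap : forall i j : 'I_n, j = i.+1 :> nat -> 'M[K]_(rdim i, rdim j)
}.

Record repmap (M N : rep) := RepMap {
  rmx :> forall i, 'M[K]_(M i, N i);
  rmx_comm : forall (i j : 'I_n) (h : j = i.+1 :> nat),
    rmap M h *m rmx j = rmx i *m rmap N h
}.

Program Definition rep_sum (M N : rep) : rep :=
  @Rep (fun i => M i + N i)%N
    (fun i j h => block_mx (rmap M h) 0 0 (rmap N h)).

Program Definition repmap_opp M N (f : repmap M N) : repmap M N :=
  @RepMap M N (fun i => - f i) _.
Next Obligation. by move=> M N f i j h; rewrite mulmxN mulNmx rmx_comm. Qed.

End Representations.

Section Complexes.
Variables (K : fieldType) (n : nat).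

Record cpx := Cpx {
  cob :> int -> rep K n;
  cd : forall k, repmap (cob k) (cob (k + 1));
  cd_cd : forall k i, cd k i *m cd (k + 1) i = 0;
  cbounded : exists N : nat, forall k i, (N < `|k|)%N -> cob k i = 0%N
}.

Record cmap (X Y : cpx) := CMap {
  cmx :> forall k, repmap (X k) (Y k);
  cmx_comm : forall k i, cd X k i *m cmx (k + 1) i = cmx k i *m cd Y k i
}.

Lemma cmap_eq X Y (f g : cmap X Y) : (forall k i, f k i = g k i) -> f = g.
Proof.
have repmap_eq (M N : rep K n) (u v : repmap M N) : (forall i, u i = v i) -> u = v.
  case: u v => [u hu] [v hv] /= e.
  have {}e : u = v by apply: functional_extensionality_dep.
  by subst v; congr RepMap; exact: Prop_irrelevance.
case: f g => [f hf] [g hg] /= e.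
have {}e : f = g.
  by apply: functional_extensionality_dep => k; apply: repmap_eq.
by subst g; congr CMap; exact: Prop_irrelevance.
Qed.

Program Definition cmap_id X : cmap X X :=
  @CMap X X (fun k => @RepMap _ _ _ _ (fun i => 1%:M) _) _.
Next Obligation. by move=> X k i j h; rewrite mulmx1 mul1mx. Qed.
Next Obligation. by move=> X k i /=; rewrite mulmx1 mul1mx. Qed.

Program Definition cmap_comp X Y Z (g : cmap Y Z) (f : cmap X Y) : cmap X Z :=
  @CMap X Z (fun k => @RepMap _ _ _ _ (fun i => f k i *m g k i) _) _.
Next Obligation.
by move=> X Y Z g f k i j h; rewrite mulmxA rmx_comm -mulmxA rmx_comm mulmxA.
Qed.
Next Obligation.
by move=> X Y Z g f k i /=; rewrite mulmxA cmx_comm -mulmxA cmx_comm mulmxA.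
Qed.

Program Definition cmap_zero X Y : cmap X Y :=
  @CMap X Y (fun k => @RepMap _ _ _ _ (fun i => 0) _) _.
Next Obligation. by move=> X Y k i j h; rewrite mulmx0 mul0mx. Qed.
Next Obligation. by move=> X Y k i /=; rewrite mulmx0 mul0mx. Qed.

Program Definition cmap_add X Y (f g : cmap X Y) : cmap X Y :=
  @CMap X Y (fun k => @RepMap _ _ _ _ (fun i => f k i + g k i) _) _.
Next Obligation. by move=> X Y f g k i j h; rewrite mulmxDr mulmxDl !rmx_comm. Qed.
Next Obligation. by move=> X Y f g k i /=; rewrite mulmxDr mulmxDl !cmx_comm. Qed.

Program Definition cmap_scale X Y (a : K) (f : cmap X Y) : cmap X Y :=
  @CMap X Y (fun k => @RepMap _ _ _ _ (fun i => a *: f k i) _) _.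
Next Obligation. by move=> X Y a f k i j h; rewrite -scalemxAr -scalemxAl rmx_comm. Qed.
Next Obligation. by move=> X Y a f k i /=; rewrite -scalemxAr -scalemxAl cmx_comm. Qed.

(* Cycles and boundaries in cohomological degree k + 1, at the vertex i. *)
Definition is_cycle (X : cpx) k i (x : 'rV[K]_(X (k + 1) i)) :=
  x *m cd X (k + 1) i = 0.
Definition is_boundary (X : cpx) k i (x : 'rV[K]_(X (k + 1) i)) :=
  exists z : 'rV[K]_(X k i), x = z *m cd X k i.

(* H^(k+1)(f) is injective and surjective at every vertex, for all k. *)
Definition quasi_iso X Y (f : cmap X Y) :=
  forall k i,
    (forall x : 'rV[K]_(X (k + 1) i),
       is_cycle x -> is_boundary (x *m f (k + 1) i) -> is_boundary x) /\
    (forall y : 'rV[K]_(Y (k + 1) i), is_cycle y ->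
       exists2 x : 'rV[K]_(X (k + 1) i), is_cycle x & is_boundary (y - x *m f (k + 1) i)).

Program Definition cshift (X : cpx) : cpx :=
  @Cpx (fun k => X (k + 1)) (fun k => repmap_opp (cd X (k + 1))) _ _.
Next Obligation. by move=> X k i /=; rewrite mulNmx mulmxN opprK cd_cd. Qed.
Next Obligation.
move=> X; have [N hN] := cbounded X; exists N.+1 => k i hk.
by apply: hN; lia.
Qed.

Program Definition cmap_shift X Y (f : cmap X Y) : cmap (cshift X) (cshift Y) :=
  @CMap (cshift X) (cshift Y) (fun k => f (k + 1)) _.
Next Obligation. by move=> X Y f k i /=; rewrite mulNmx mulmxN cmx_comm. Qed.

Lemma quasi_iso_shift X Y (f : cmap X Y) : quasi_iso f -> quasi_iso (cmap_shift f).
Proof.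
have bE (Z : cpx) k i (z : 'rV[K]_(Z (k + 1 + 1) i)) :
    @is_boundary (cshift Z) k i z <-> @is_boundary Z (k + 1) i z.
  by split=> -[w ->]; exists (- w); rewrite /= ?mulNmx mulmxN ?opprK.
have cE (Z : cpx) k i (z : 'rV[K]_(Z (k + 1 + 1) i)) :
    @is_cycle (cshift Z) k i z <-> @is_cycle Z (k + 1) i z.
  by rewrite /is_cycle /= mulmxN; split=> [/eqP|->]; rewrite ?oppr0 ?oppr_eq0 // => /eqP.
move=> qf k i; have [h1 h2] := qf (k + 1) i; split=> [x /cE hx /bE hb|y /cE hy].
  by apply/bE; exact: h1.
by have [x hx hb] := h2 y hy; exists x; [apply/cE | apply/bE].
Qed.

(* cone(f)^k = X^(k+1) (+) Y^k with differential (x, y) |-> (-dx, fx + dy). *)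
Section Cone.
Variables (X Y : cpx) (f : cmap X Y).

Program Definition cone : cpx :=
  @Cpx (fun k => rep_sum (X (k + 1)) (Y k))
    (fun k => @RepMap _ _ _ _
      (fun i => block_mx (- cd X (k + 1) i) (f (k + 1) i) 0 (cd Y k i)) _) _ _.
Next Obligation.
move=> k i j h /=; rewrite !mulmx_block !mulmx0 !mul0mx !addr0 !add0r.
by rewrite mulmxN mulNmx !rmx_comm.
Qed.
Next Obligation.
move=> k i /=; rewrite mulmx_block !mulmx0 !mul0mx !addr0 !add0r mulNmx mulmxN.
by rewrite !cd_cd !oppr0 mulNmx cmx_comm addNr /block_mx !row_mx0 col_mx0.
Qed.
Next Obligation.
have [N hN] := cbounded X; have [M hM] := cbounded Y.
exists (N + M).+1 => k i hk /=; rewrite hN ?hM //; lia.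
Qed.

Program Definition cone_in : cmap Y cone :=
  @CMap Y cone (fun k => @RepMap _ _ _ _ (fun i => row_mx 0 1%:M) _) _.
Next Obligation.
move=> k i j h /=; rewrite mul_mx_row mul_row_block.
by rewrite !mulmx0 !mul0mx mulmx1 mul1mx !add0r.
Qed.
Next Obligation.
move=> k i /=; rewrite mul_mx_row mul_row_block.
by rewrite !mulmx0 !mul0mx mulmx1 mul1mx !add0r.
Qed.

Program Definition cone_out : cmap cone (cshift X) :=
  @CMap cone (cshift X) (fun k => @RepMap _ _ _ _ (fun i => col_mx 1%:M 0) _) _.
Next Obligation.
move=> k i j h /=; rewrite mul_block_col mul_col_mx.
by rewrite !mulmx0 !mul0mx mulmx1 mul1mx !addr0.
Qed.
Next Obligation.
move=> k i /=; rewrite mul_block_col mul_col_mx.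
by rewrite !mulmx0 !mul0mx mulmx1 mul1mx !addr0.
Qed.

End Cone.

End Complexes.

(* D^b(mod K A_n) is the K-linear localization of the category of bounded    *)
(* complexes at the quasi-isomorphisms, presented by generators (chain maps  *)
(* and formal inverses of quasi-isomorphisms) and relations.  As the class   *)
(* of quasi-isomorphisms contains identities and is stable under direct      *)
(* sums, inverting it linearly is the same as inverting it.                  *)

Section DerivedCategory.
Variables (K : fieldType) (n : nat).
Local Notation cpx := (cpx K n).

Inductive dterm : cpx -> cpx -> Type :=
| Dmap X Y : cmap X Y -> dterm X Y
| Dinv X Y (q : cmap X Y) : quasi_iso q -> dterm Y X
| Dcomp X Y Z : dterm Y Z -> dterm X Y -> dterm X Z
| Dadd X Y : dterm X Y -> dterm X Y -> dterm X Y
| Dscale X Y : K -> dterm X Y -> dterm X Y.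

Local Notation Did X := (Dmap (cmap_id X)).
Local Notation D0 X Y := (Dmap (cmap_zero X Y)).

Inductive deq : forall X Y, dterm X Y -> dterm X Y -> Prop :=
| deq_refl X Y (s : dterm X Y) : deq s s
| deq_sym X Y (s t : dterm X Y) : deq s t -> deq t s
| deq_trans X Y (s t u : dterm X Y) : deq s t -> deq t u -> deq s u
| deq_comp X Y Z (s s' : dterm Y Z) (t t' : dterm X Y) :
    deq s s' -> deq t t' -> deq (Dcomp s t) (Dcomp s' t')
| deq_add X Y (s s' t t' : dterm X Y) :
    deq s s' -> deq t t' -> deq (Dadd s t) (Dadd s' t')
| deq_scale X Y a (s s' : dterm X Y) : deq s s' -> deq (Dscale a s) (Dscale a s')
| deq_addA X Y (s t u : dterm X Y) : deq (Dadd s (Dadd t u)) (Dadd (Dadd s t) u)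
| deq_addC X Y (s t : dterm X Y) : deq (Dadd s t) (Dadd t s)
| deq_add0 X Y (s : dterm X Y) : deq (Dadd (D0 X Y) s) s
| deq_addN X Y (s : dterm X Y) : deq (Dadd (Dscale (-1) s) s) (D0 X Y)
| deq_scaleA X Y a b (s : dterm X Y) :
    deq (Dscale a (Dscale b s)) (Dscale (a * b) s)
| deq_scale1 X Y (s : dterm X Y) : deq (Dscale 1 s) s
| deq_scaleDr X Y a (s t : dterm X Y) :
    deq (Dscale a (Dadd s t)) (Dadd (Dscale a s) (Dscale a t))
| deq_scaleDl X Y a b (s : dterm X Y) :
    deq (Dscale (a + b) s) (Dadd (Dscale a s) (Dscale b s))
| deq_compA X Y Z W (s : dterm Z W) (t : dterm Y Z) (u : dterm X Y) :
    deq (Dcomp s (Dcomp t u)) (Dcomp (Dcomp s t) u)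
| deq_comp1m X Y (s : dterm X Y) : deq (Dcomp (Did Y) s) s
| deq_compm1 X Y (s : dterm X Y) : deq (Dcomp s (Did X)) s
| deq_compPl X Y Z a (s s' : dterm Y Z) (t : dterm X Y) :
    deq (Dcomp (Dadd (Dscale a s) s') t)
        (Dadd (Dscale a (Dcomp s t)) (Dcomp s' t))
| deq_compPr X Y Z a (s : dterm Y Z) (t t' : dterm X Y) :
    deq (Dcomp s (Dadd (Dscale a t) t'))
        (Dadd (Dscale a (Dcomp s t)) (Dcomp s t'))
| deq_mapM X Y Z (g : cmap Y Z) (f : cmap X Y) :
    deq (Dmap (cmap_comp g f)) (Dcomp (Dmap g) (Dmap f))
| deq_mapD X Y (f g : cmap X Y) :
    deq (Dmap (cmap_add f g)) (Dadd (Dmap f) (Dmap g))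
| deq_mapZ X Y a (f : cmap X Y) :
    deq (Dmap (cmap_scale a f)) (Dscale a (Dmap f))
| deq_invl X Y (q : cmap X Y) (h : quasi_iso q) :
    deq (Dcomp (Dinv h) (Dmap q)) (Did X)
| deq_invr X Y (q : cmap X Y) (h : quasi_iso q) :
    deq (Dcomp (Dmap q) (Dinv h)) (Did Y).

Section Hom.
Variables X Y : cpx.

Definition deqb (s t : {classic dterm X Y}) : bool := `[< deq s t >].

Fact deqb_refl : reflexive deqb.
Proof. by move=> s; apply/asboolP/deq_refl. Qed.
Fact deqb_sym : symmetric deqb.
Proof. by move=> s t; apply/asboolP/asboolP; exact: deq_sym. Qed.
Fact deqb_trans : transitive deqb.
Proof. by move=> t s u /asboolP h /asboolP h'; apply/asboolP/(deq_trans h). Qed.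

Canonical deqb_equiv := EquivRel deqb deqb_refl deqb_sym deqb_trans.

Definition dhom := {eq_quot deqb}.
HB.instance Definition _ := Choice.on dhom.

End Hom.

Definition dcls X Y (s : dterm X Y) : dhom X Y := \pi_(dhom X Y) (s : {classic _}).
Definition drepr X Y (u : dhom X Y) : dterm X Y := repr u.

Lemma dclsP X Y (s t : dterm X Y) : dcls s = dcls t <-> deq s t.
Proof.
rewrite /dcls; split; last by move=> h; apply/eqmodP/asboolP.
by move/eqmodP/asboolP.
Qed.

Lemma dreprK X Y (u : dhom X Y) : dcls (drepr u) = u.
Proof. exact: reprK. Qed.

Lemma drepr_deq X Y (s : dterm X Y) : deq (drepr (dcls s)) s.
Proof. by apply/dclsP; rewrite dreprK. Qed.

Definition dadd X Y (u v : dhom X Y) := dcls (Dadd (drepr u) (drepr v)).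
Definition dscale X Y a (u : dhom X Y) := dcls (Dscale a (drepr u)).
Definition dcomp X Y Z (u : dhom Y Z) (v : dhom X Y) :=
  dcls (Dcomp (drepr u) (drepr v)).

Lemma daddE X Y (s t : dterm X Y) : dadd (dcls s) (dcls t) = dcls (Dadd s t).
Proof. by apply/dclsP/deq_add; exact: drepr_deq. Qed.
Lemma dscaleE X Y a (s : dterm X Y) : dscale a (dcls s) = dcls (Dscale a s).
Proof. by apply/dclsP/deq_scale; exact: drepr_deq. Qed.
Lemma dcompE X Y Z (s : dterm Y Z) (t : dterm X Y) :
  dcomp (dcls s) (dcls t) = dcls (Dcomp s t).
Proof. by apply/dclsP/deq_comp; exact: drepr_deq. Qed.

Section HomModule.
Variables X Y : cpx.

Fact daddA : associative (@dadd X Y).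
Proof.
move=> u v w; rewrite -(dreprK u) -(dreprK v) -(dreprK w) !daddE.
exact/dclsP/deq_addA.
Qed.
Fact daddC : commutative (@dadd X Y).
Proof. by move=> u v; exact/dclsP/deq_addC. Qed.
Fact dadd0 : left_id (dcls (D0 X Y)) (@dadd X Y).
Proof. by move=> u; rewrite -(dreprK u) daddE; exact/dclsP/deq_add0. Qed.
Fact daddN : left_inverse (dcls (D0 X Y)) (dscale (-1)) (@dadd X Y).
Proof. by move=> u; rewrite -(dreprK u) dscaleE daddE; exact/dclsP/deq_addN. Qed.
HB.instance Definition _ :=
  GRing.isZmodule.Build (dhom X Y) daddA daddC dadd0 daddN.

Fact dscaleA a b (u : dhom X Y) : dscale a (dscale b u) = dscale (a * b) u.
Proof. by rewrite -(dreprK u) !dscaleE; exact/dclsP/deq_scaleA. Qed.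
Fact dscale1 : left_id 1 (@dscale X Y).
Proof. by move=> u; rewrite -(dreprK u) dscaleE; exact/dclsP/deq_scale1. Qed.
Fact dscaleDr : right_distributive (@dscale X Y) +%R.
Proof.
move=> a u v; rewrite -(dreprK u) -(dreprK v) [_ + _]daddE !dscaleE.
by rewrite [_ + _]daddE; exact/dclsP/deq_scaleDr.
Qed.
Fact dscaleDl (u : dhom X Y) : {morph (@dscale X Y)^~ u : a b / a + b}.
Proof.
move=> a b; rewrite -(dreprK u) !dscaleE [RHS]daddE.
exact/dclsP/deq_scaleDl.
Qed.
HB.instance Definition _ := GRing.Zmodule_isLmodule.Build K (dhom X Y)
  dscaleA dscale1 dscaleDr dscaleDl.

End HomModule.

Lemma dlinE X Y a (s t : dterm X Y) :
  a *: dcls s + dcls t = dcls (Dadd (Dscale a s) t).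
Proof. by rewrite [_ *: _]dscaleE [LHS]daddE. Qed.

Fact dcompA X Y Z W (u : dhom Z W) (v : dhom Y Z) (w : dhom X Y) :
  dcomp u (dcomp v w) = dcomp (dcomp u v) w.
Proof.
rewrite -(dreprK u) -(dreprK v) -(dreprK w) !dcompE.
exact/dclsP/deq_compA.
Qed.
Fact dcomp1m X Y (u : dhom X Y) : dcomp (dcls (Did Y)) u = u.
Proof. by rewrite -(dreprK u) dcompE; exact/dclsP/deq_comp1m. Qed.
Fact dcompm1 X Y (u : dhom X Y) : dcomp u (dcls (Did X)) = u.
Proof. by rewrite -(dreprK u) dcompE; exact/dclsP/deq_compm1. Qed.
Fact dcompPl X Y Z a (u u' : dhom Y Z) (v : dhom X Y) :
  dcomp (a *: u + u') v = a *: dcomp u v + dcomp u' v.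
Proof.
rewrite -(dreprK u) -(dreprK u') -(dreprK v).
by rewrite dlinE !dcompE dlinE; exact/dclsP/deq_compPl.
Qed.
Fact dcompPr X Y Z a (u : dhom Y Z) (v v' : dhom X Y) :
  dcomp u (a *: v + v') = a *: dcomp u v + dcomp u v'.
Proof.
rewrite -(dreprK u) -(dreprK v) -(dreprK v').
by rewrite dlinE !dcompE dlinE; exact/dclsP/deq_compPr.
Qed.

Definition Db : linCat K := LinCat dcompA dcomp1m dcompm1 dcompPl dcompPr.

Fixpoint dterm_shift X Y (s : dterm X Y) : dterm (cshift X) (cshift Y) :=
  match s with
  | Dmap _ _ f => Dmap (cmap_shift f)
  | Dinv _ _ _ h => Dinv (quasi_iso_shift h)
  | Dcomp _ _ _ s t => Dcomp (dterm_shift s) (dterm_shift t)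
  | Dadd _ _ s t => Dadd (dterm_shift s) (dterm_shift t)
  | Dscale _ _ a s => Dscale a (dterm_shift s)
  end.

Lemma deq_shift X Y (s t : dterm X Y) :
  deq s t -> deq (dterm_shift s) (dterm_shift t).
Proof.
have idE Z : cmap_shift (cmap_id Z) = cmap_id (cshift Z) by exact: cmap_eq.
have zE Z W : cmap_shift (cmap_zero Z W) = cmap_zero (cshift Z) (cshift W).
  exact: cmap_eq.
have MS Z W V (g : cmap W V) (f : cmap Z W) : cmap_shift (cmap_comp g f) =
  cmap_comp (cmap_shift g) (cmap_shift f) by exact: cmap_eq.
have DS Z W (f g : cmap Z W) : cmap_shift (cmap_add f g) =
  cmap_add (cmap_shift f) (cmap_shift g) by exact: cmap_eq.
have ZS Z W a (f : cmap Z W) : cmap_shift (cmap_scale a f) =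
  cmap_scale a (cmap_shift f) by exact: cmap_eq.
elim=> /= *; rewrite ?idE ?zE ?MS ?DS ?ZS;
  try (by constructor); by eapply deq_trans; eassumption.
Qed.

Definition dshift X Y (u : dhom X Y) : dhom (cshift X) (cshift Y) :=
  dcls (dterm_shift (drepr u)).

Lemma dshiftE X Y (s : dterm X Y) : dshift (dcls s) = dcls (dterm_shift s).
Proof. exact/dclsP/deq_shift/drepr_deq. Qed.

Fact dshift_linear X Y a (u v : dhom X Y) :
  dshift (a *: u + v) = a *: dshift u + dshift v.
Proof. by rewrite -(dreprK u) -(dreprK v) dlinE !dshiftE dlinE. Qed.
HB.instance Definition _ X Y :=
  GRing.isLinear.Build K (dhom X Y) (dhom (cshift X) (cshift Y)) _
    (@dshift X Y) (@dshift_linear X Y).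

Fact dshift1 X : dshift (dcls (Did X)) = dcls (Did (cshift X)).
Proof. by rewrite dshiftE /=; congr (dcls (Dmap _)); exact: cmap_eq. Qed.

Fact dshiftM X Y Z (u : dhom Y Z) (v : dhom X Y) :
  dshift (dcomp u v) = dcomp (dshift u) (dshift v).
Proof. by rewrite -(dreprK u) -(dreprK v) dcompE !dshiftE dcompE. Qed.

Definition Db_susp : functor Db Db :=
  @Functor K Db Db (@cshift K n) (fun X Y => @dshift X Y) dshift1 dshiftM.

Definition Db_map X Y (f : cmap X Y) : hom (X : Db) (Y : Db) := dcls (Dmap f).

Definition Db_dist (X Y Z : Db) (u : hom X Y) (v : hom Y Z)
    (w : hom Z (Db_susp X)) : Prop :=
  exists (A B : cpx) (f : cmap A B) (a : hom X (A : Db)) (b : hom Y (B : Db))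
    (c : hom Z (cone f : Db)),
    [/\ is_iso a, is_iso b & is_iso c] /\
    [/\ Db_map f \c a = b \c u, Db_map (cone_in f) \c b = c \c v
      & Db_map (cone_out f) \c c = fmap Db_susp a \c w].

Definition Db_tri : tri_data Db := TriData Db_dist.

End DerivedCategory.

(* (tau^-1 Sigma)^p, whose orbit category is the repetitive cluster category *)
Definition rcc_functor (K : fieldType) (n p : nat)
    (t : ar_translation (Db_tri K n)) : functor (Db K n) (Db K n) :=
  fiter p (fcomp (ae_inv t) (susp (Db_tri K n))).

(* Main.v *)
Require Import Defs.
From HB Require Import structures.
From mathcomp Require Import generic_quotient ring_quotient.
From mathcomp Require Import boolp classical_sets cardinality fsbigop.
From mathcomp.multinomials Require Import freeg.
From mathcomp Require Import zify.

(** Let [dimv X] in Z^n be the dimension vector of a complex X, counted with the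
    sign of the degree.  A function on D^b(mod K A_n) that is additive on
    triangles is determined by its values on the simple modules, because every
    complex is an iterated extension of shifted simples; hence it factors
    through [dimv] ([additive_vanish_simple], [additive_dimv]).  In particular
    the class of X in the Grothendieck group of the orbit category is
    l (dimv X) for an additive map l from Z^n.

    In the orbit category X is isomorphic to (tau^-1 Sigma)^p X
    ([orbit_power_iso]), so l is invariant under the effect of this functor on
    dimension vectors.  Sigma acts on them by -1 and tau by the matrix
    [coxeter], which permutes cyclically the n+1 vectors e_0, ..., e_(n-1) and
    e_n = -(e_0 + ... + e_(n-1)); it has period n+1.  When p is 1 or -1 modulo
    2(n+1), p is odd and the invariance reads l (c v) = - l v, where c is the
    action of tau or of its inverse, and therefore for both.  Then the l e_i
    alternate in sign, and for n even their sum over i < n vanishes.  That sum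
    is - l e_n, which equals l e_0 up to sign, so l = 0
    ([coxeter_antiinvariant]).

    The substance is the action of tau ([dimv_tau]), since tau is known only
    through Serre duality.  Let P_j be the projective module at the vertex j.
    Maps in the derived category from a shift of P_j to X form the cohomology of
    X at j in the corresponding degree ([hom_proj_dim]), and maps from P_j[a] to
    Sigma (tau P_i) are dual to maps from P_i to P_j[a].  So the cohomology of
    Sigma (tau P_i), hence its dimension vector ([dimv_coh]), is known.  As tau
    is exact and the projectives generate, this determines the action of tau on
    all dimension vectors.

    The derived category is presented by generators and relations, so a map out
    of P_j is computed by letting every term act on cycles modulo boundaries:
    the action respects the relations ([deq_coh_act]), and it determines the
    map because null-homotopic maps vanish ([null_homotopic]).  The same
    identification of maps with cohomology shows that the dimension vector is
    an isomorphism invariant ([dimv_iso]). *)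

Set Implicit Arguments.
Unset Strict Implicit.
Unset Printing Implicit Defensive.

Import Order.TTheory GRing.Theory Num.Theory.
Local Open Scope ring_scope.

#[local] Obligation Tactic := idtac.

(** * Isomorphisms and triangles in the derived category *)
Section Isos.
Variables (K : fieldType) (C : linCat K).

Lemma is_iso_id (X : C) : is_iso (idm X).
Proof. by exists (idm X); rewrite comp1m. Qed.

Lemma is_iso_sym (X Y : C) (f : hom X Y) (g : hom Y X) :
  g \c f = idm X -> f \c g = idm Y -> is_iso g.
Proof. by move=> gf fg; exists f. Qed.

Lemma is_iso_fmap (D : linCat K) (F : functor C D) (X Y : C) (f : hom X Y) :
  is_iso f -> is_iso (fmap F f).
Proof. by case=> g [gf fg]; exists (fmap F g); rewrite -!fmapM gf fg !fmap1. Qed.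

End Isos.

(** The functions that factor through the Grothendieck group of a triangulated
    category. *)
Definition tri_additive (K : fieldType) (C : linCat K) (t : tri_data C)
    (G : zmodType) (L : C -> G) :=
  forall (X Y Z : C) (u : hom X Y) (v : hom Y Z) (w : hom Z (susp t X)),
    dist t u v w -> L Y = L X + L Z.

Section Derived.
Variables (K : fieldType) (n : nat).
Local Notation cpx := (cpx K n).
Local Notation Db := (Db K n).
Local Notation Db_tri := (Db_tri K n).
Implicit Types X Y Z A B : cpx.

Lemma Db_mapM X Y Z (g : cmap Y Z) (f : cmap X Y) :
  Db_map (cmap_comp g f) = Db_map g \c Db_map f :> hom (X : Db) (Z : Db).
Proof. by rewrite /= dcompE; apply/dclsP/deq_mapM. Qed.

Lemma Db_map1 X : Db_map (cmap_id X) = idm (X : Db).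
Proof. by []. Qed.

Lemma Db_map0 X Y : Db_map (cmap_zero X Y) = 0 :> hom (X : Db) (Y : Db).
Proof. by []. Qed.

Lemma Db_mapD X Y (f g : cmap X Y) :
  Db_map (cmap_add f g) = Db_map f + Db_map g :> hom (X : Db) (Y : Db).
Proof. by rewrite [RHS]daddE; apply/dclsP/deq_mapD. Qed.

Lemma Db_mapZ X Y a (f : cmap X Y) :
  Db_map (cmap_scale a f) = a *: Db_map f :> hom (X : Db) (Y : Db).
Proof. by rewrite [RHS]dscaleE; apply/dclsP/deq_mapZ. Qed.

Lemma quasi_iso_is_iso X Y (q : cmap X Y) :
  quasi_iso q -> is_iso (Db_map q : hom (X : Db) (Y : Db)).
Proof.
move=> h; exists (dcls (Dinv h)); split; rewrite /= dcompE; apply/dclsP.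
  exact: deq_invl.
exact: deq_invr.
Qed.

Definition acyclic X := forall k i (x : 'rV[K]_(X (k + 1) i)),
  is_cycle x -> is_boundary x.

(** The zero endomorphism of an acyclic complex is a quasi-isomorphism, so zero
    becomes invertible. *)
Lemma acyclic_zero X : acyclic X -> idm (X : Db) = 0.
Proof.
move=> aX; have q0 : quasi_iso (cmap_zero X X).
  move=> k i; split=> [x /aX //|y /aX hy]; exists 0; first by rewrite /is_cycle mul0mx.
  by rewrite mul0mx subr0.
have [g [gf _]] := quasi_iso_is_iso q0.
by rewrite -gf Db_map0 compm0.
Qed.

Lemma cone_id_acyclic X : acyclic (cone (cmap_id X)).
Proof.
move=> k i x; rewrite -[x]hsubmxK; move: (lsubmx x) (rsubmx x) => a b.
rewrite /is_cycle /= mul_row_block mulmx0 addr0 mulmx1.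
move=> /eqP; rewrite row_mx_eq0 => /andP [_ /eqP ab].
exists (row_mx b 0); rewrite /= mul_row_block mulmx1 !mul0mx !addr0 mulmxN.
by rewrite -(addr0_eq ab) opprK.
Qed.

(** A null-homotopy h of f extends f along the inclusion of A into the cone of
    its identity, and that cone is a zero object. *)
Lemma null_homotopic A X (f : cmap A X) (h : forall k : int, repmap (A (k + 1)) (X k)) :
  (forall k i, f (k + 1) i = h k i *m cd X k i + cd A (k + 1) i *m h (k + 1) i) ->
  Db_map f = 0 :> hom (A : Db) (X : Db).
Proof.
move=> fh.
have ec k (i j : 'I_n) (e : j = i.+1 :> nat) :
    rmap (cone (cmap_id A) k) e *m col_mx (h k j) (f k j) =
    col_mx (h k i) (f k i) *m rmap (X k) e.
  by rewrite /= mul_block_col !mul0mx addr0 add0r mul_col_mx !rmx_comm.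
pose g0 k := @RepMap K n (cone (cmap_id A) k) (X k)
  (fun i => col_mx (h k i) (f k i)) (ec k).
have gd k i : cd (cone (cmap_id A)) k i *m g0 (k + 1) i = g0 k i *m cd X k i.
  rewrite /= mul_block_col mul1mx mul0mx add0r mul_col_mx cmx_comm fh mulNmx.
  by rewrite addrCA addNr addr0.
pose g := CMap gd.
have -> : f = cmap_comp g (cone_in (cmap_id A)).
  by apply: cmap_eq => k i /=; rewrite mul_row_col mul0mx mul1mx add0r.
rewrite Db_mapM -(comp1m (Db_map (cone_in _))).
by rewrite (acyclic_zero (@cone_id_acyclic A)) comp0m compm0.
Qed.

(** Short exactness of 0 -> A -> B -> Z -> 0, certified by splittings of each
    sequence of coordinate spaces; f' and g' need not commute with anything. *)
Definition pointwise_exact A B Z (f : cmap A B) (g : cmap B Z) :=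
  forall k i, exists (f' : 'M_(B k i, A k i)) (g' : 'M_(Z k i, B k i)),
    [/\ f k i *m f' = 1%:M, g' *m g k i = 1%:M, f k i *m g k i = 0
      & f' *m f k i + g k i *m g' = 1%:M].

Section ShortExact.
Variables (A B Z : cpx) (f : cmap A B) (g : cmap B Z).
Hypothesis fg_ex : pointwise_exact f g.

Let fg0 k i : f k i *m g k i = 0. Proof. by have [? [? []]] := fg_ex k i. Qed.

Lemma cone_to_coker_rep k (i j : 'I_n) (e : j = i.+1 :> nat) :
  rmap (cone f k) e *m col_mx 0 (g k j) = col_mx 0 (g k i) *m rmap (Z k) e.
Proof. by rewrite /= mul_block_col !mulmx0 !mul0mx !add0r mul_col_mx mul0mx rmx_comm. Qed.

Lemma cone_to_coker_comm k i :
  cd (cone f) k i *m col_mx 0 (g (k + 1) i) = col_mx 0 (g k i) *m cd Z k i.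
Proof.
by rewrite /= mul_block_col !mulmx0 !add0r mul_col_mx mul0mx fg0 cmx_comm.
Qed.

(** In a short exact sequence the cone of the inclusion is a resolution of the
    quotient, which makes the sequence a triangle. *)
Definition cone_to_coker : cmap (cone f) Z :=
  @CMap _ _ (cone f) Z (fun k => RepMap (@cone_to_coker_rep k)) cone_to_coker_comm.

Lemma cone_to_coker_quasi_iso : quasi_iso cone_to_coker.
Proof.
move=> k i; have [f1 [g1 [ff gg _ sp]]] := fg_ex (k + 1) i.
have [f2 [g2 [ff2 _ _ sp2]]] := fg_ex (k + 1 + 1) i.
have [f0 [g0 [_ gg0 _ _]]] := fg_ex k i.
have kerg m (b : 'M_(m, _)) : b *m g (k + 1) i = 0 -> b *m f1 *m f (k + 1) i = b.
  by move=> bg; rewrite -mulmxA -[f1 *m _](addrK (g (k + 1) i *m g1)) sp mulmxBr mulmx1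
    mulmxA bg mul0mx subr0.
have kerg2 m (b : 'M_(m, _)) : b *m g (k + 1 + 1) i = 0 -> b *m f2 *m f (k + 1 + 1) i = b.
  by move=> bg; rewrite -mulmxA -[f2 *m _](addrK (g (k + 1 + 1) i *m g2)) sp2 mulmxBr mulmx1
    mulmxA bg mul0mx subr0.
have injf2 m (a : 'M_(m, _)) b : a *m f (k + 1 + 1) i = b *m f (k + 1 + 1) i -> a = b.
  by move=> e; rewrite -[a]mulmx1 -[b]mulmx1 -ff2 !mulmxA e.
split=> [x|y].
  rewrite -[x]hsubmxK; move: (lsubmx x) (rsubmx x) => a b.
  rewrite /is_cycle /= mul_row_block mulmx0 addr0 => /eqP.
  rewrite row_mx_eq0 => /andP [_ /eqP ab] [c]; rewrite mul_row_col mulmx0 add0r => bc.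
  pose v := c *m g0.
  have uv : (b - v *m cd B k i) *m g (k + 1) i = 0.
    by rewrite mulmxBl bc -!mulmxA cmx_comm [g0 *m _]mulmxA gg0 mul1mx subrr.
  exists (row_mx ((b - v *m cd B k i) *m f1) v).
  rewrite /= mul_row_block mulmx0 addr0 kerg // subrK; congr row_mx.
  apply: injf2; rewrite mulmxN mulNmx -mulmxA cmx_comm mulmxA kerg //.
  by rewrite mulmxBl -[v *m _ *m _]mulmxA cd_cd mulmx0 subr0 -(addr0_eq ab) opprK.
rewrite /is_cycle => hy; pose b := y *m g1.
have bd : b *m cd B (k + 1) i *m g (k + 1 + 1) i = 0.
  by rewrite -mulmxA cmx_comm /b -mulmxA [g1 *m _]mulmxA gg mul1mx hy.
exists (row_mx (- (b *m cd B (k + 1) i *m f2)) b); last first.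
  exists 0; rewrite mul0mx /= mul_row_col mulmx0 add0r /b -mulmxA gg mulmx1.
  exact: subrr.
rewrite /is_cycle /= mul_row_block mulmx0 addr0 !mulNmx mulmxN opprK kerg2 //.
rewrite addNr.
have [f3 [_ [ff3 _ _ _]]] := fg_ex (k + 1 + 1 + 1) i.
have -> : b *m cd B (k + 1) i *m f2 *m cd A (k + 1 + 1) i = 0.
  rewrite -[LHS]mulmx1 -ff3 mulmxA -[X in X *m f3]mulmxA cmx_comm mulmxA kerg2 //.
  by rewrite -[b *m _ *m _]mulmxA cd_cd mulmx0 mul0mx.
exact: row_mx0.
Qed.

Lemma dist_short_exact : exists w : hom (Z : Db) (susp Db_tri A),
  dist Db_tri (Db_map f : hom (A : Db) (B : Db)) (Db_map g : hom (B : Db) (Z : Db)) w.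
Proof.
have [c [cq qc]] := quasi_iso_is_iso cone_to_coker_quasi_iso.
exists (Db_map (cone_out f) \c c), A, B, f, (idm (A : Db)), (idm (B : Db)), c.
split; first by split; [exact: is_iso_id | exact: is_iso_id | exact: is_iso_sym qc].
split; rewrite ?comp1m ?compm1 ?fmap1 ?comp1m //.
have -> : g = cmap_comp cone_to_coker (cone_in f).
  by apply: cmap_eq => k i /=; rewrite mul_row_col mul0mx mul1mx add0r.
by rewrite Db_mapM compA cq comp1m.
Qed.

End ShortExact.

Section Additive.
Variables (G : zmodType) (L : Db -> G).
Hypothesis L_add : tri_additive Db_tri L.

Lemma additive_exact A B Z (f : cmap A B) (g : cmap B Z) :
  pointwise_exact f g -> L B = L A + L Z.
Proof. by move=> /dist_short_exact [w /L_add]. Qed.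

Lemma additive_cone A B (f : cmap A B) : L B = L A + L (cone f).
Proof.
apply: (L_add (u := Db_map f) (v := Db_map (cone_in f)) (w := Db_map (cone_out f))).
exists A, B, f, (idm (A : Db)), (idm (B : Db)), (idm (cone f : Db)).
split; first by split; exact: is_iso_id.
by split; rewrite ?comp1m ?compm1 // fmap1 comp1m.
Qed.

(** X, Y and a cone of an identity form a triangle, and an additive function
    kills such a cone. *)
Lemma additive_iso X Y (f : hom (X : Db) (Y : Db)) : is_iso f -> L X = L Y.
Proof.
case=> g [gf fg].
have e : L X = L Y + L (cone (cmap_id X)).
  pose q := cmap_id X.
  apply: (L_add (u := g) (v := Db_map (cone_in q))
    (w := fmap (susp Db_tri) f \c Db_map (cone_out q))).
  exists X, X, q, g, (idm (X : Db)), (idm (cone q : Db)).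
  split; first by split; [exact: (is_iso_sym gf fg) | exact: is_iso_id | exact: is_iso_id].
  by split; rewrite ?comp1m ?compm1 // compA -fmapM gf fmap1 comp1m.
have e0 : L (cone (cmap_id X)) = 0.
  by apply: (addrI (L X)); rewrite -additive_cone addr0.
by rewrite e e0 addr0.
Qed.

(** The sequence 0 -> X -> cone(id) -> X[1] -> 0 is exact with a middle term
    that an additive function kills. *)
Lemma additive_shift X : L (cshift X) = - L X.
Proof.
have ex : pointwise_exact (cone_in (cmap_id X)) (cone_out (cmap_id X)).
  move=> k i; exists (col_mx 0 1%:M), (row_mx 1%:M 0); split=> /=.
  - by rewrite mul_row_col mul0mx mul1mx add0r.
  - by rewrite mul_row_col mul0mx mul1mx addr0.
  - by rewrite mul_row_col mul0mx mulmx0 addr0.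
  - rewrite !mul_col_row !mulmx0 !mul0mx !mul1mx add_block_mx !addr0 !add0r.
    by rewrite -scalar_mx_block.
apply: (addrI (L X)); rewrite -(additive_exact ex) subrr.
by apply: (addrI (L X)); rewrite -additive_cone addr0.
Qed.

End Additive.
End Derived.

(** * Filtration of a complex by shifted simple modules *)
Section Masking.
Variable K : fieldType.

(** The identity between coordinate spaces of propositionally equal dimension,
    which saves casts; it is also the only matrix to or from a zero space. *)
Definition idmx m n : 'M[K]_(m, n) := pid_mx m.

Lemma idmx1 m : idmx m m = 1%:M. Proof. exact: pid_mx_1. Qed.

Lemma idmxK m n : m = n -> idmx m n *m idmx n m = 1%:M.
Proof. by move=> ->; rewrite idmx1 mulmx1. Qed.

Definition mask_dim (b : bool) (d : nat) := if b then d else 0%N.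

(** The block of A that survives when the source is kept only if b1 holds and
    the target only if b2 holds. *)
Definition mask_mx b1 b2 d1 d2 (A : 'M[K]_(d1, d2)) :
  'M[K]_(mask_dim b1 d1, mask_dim b2 d2) :=
  idmx _ _ *m A *m idmx _ _.
Arguments mask_mx b1 b2 {d1 d2} A.

Lemma mask_mx_true d1 d2 (A : 'M[K]_(d1, d2)) : mask_mx true true A = A.
Proof. by rewrite /mask_mx !idmx1 mulmx1 mul1mx. Qed.

Lemma mask_mx_false b1 b2 d1 d2 (A : 'M[K]_(d1, d2)) : ~~ (b1 && b2) -> mask_mx b1 b2 A = 0.
Proof. by case: b1 b2 => [] [] // _; [exact: thinmx0 | exact: flatmx0 ..]. Qed.

Lemma mask_mx_id b d : mask_mx b b (1%:M : 'M[K]_d) = 1%:M.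
Proof. by case: b; [rewrite mask_mx_true | rewrite mask_mx_false // [RHS]flatmx0]. Qed.

Lemma mask_mx_mul (b1 b2 b3 : bool) d1 d2 d3 (A : 'M[K]_(d1, d2)) (B : 'M[K]_(d2, d3)) :
  (b1 -> b3 -> b2) -> mask_mx b1 b2 A *m mask_mx b2 b3 B = mask_mx b1 b3 (A *m B).
Proof.
case: b1 => [|_]; last by rewrite !(@mask_mx_false false) // mul0mx.
case: b3 => [|_]; last by rewrite !(@mask_mx_false _ false) ?andbF // mulmx0.
by move=> /(_ isT isT) ->; rewrite !mask_mx_true.
Qed.

Lemma mask_mx_split (b bl bh : bool) d : b = bl || bh -> ~~ (bl && bh) ->
  mask_mx b bl (1%:M : 'M[K]_d) *m mask_mx bl b 1%:M
    + mask_mx b bh 1%:M *m mask_mx bh b 1%:M = 1%:M.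
Proof.
by move=> ->; case: bl bh => [] [] //= _;
  rewrite ?mask_mx_true ?(mask_mx_false, mul0mx) // ?mulmx1 ?addr0 ?add0r // [RHS]flatmx0.
Qed.

End Masking.
Arguments mask_mx {K} b1 b2 {d1 d2} A.

Section Complexes.
Variables (K : fieldType) (n : nat).
Local Notation cpx := (cpx K n).
Local Notation Db := (Db K n).
Local Notation Db_tri := (Db_tri K n).
Implicit Types X Y : cpx.

Section SameDimensions.
Variables X Y : cpx.
Hypothesis dimE : forall k i, X k i = Y k i :> nat.
Hypothesis rE : forall k (i j : 'I_n) (e : j = i.+1 :> nat),
  rmap (X k) e *m idmx K (X k j) (Y k j) = idmx K (X k i) (Y k i) *m rmap (Y k) e.
Hypothesis dE : forall k i,
  cd X k i *m idmx K (X (k + 1) i) (Y (k + 1) i) = idmx K (X k i) (Y k i) *m cd Y k i.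

(** The components are the identifications of coordinate spaces of equal
    dimension, in both directions. *)
Lemma same_dim_iso : exists f : hom (X : Db) (Y : Db), is_iso f.
Proof.
pose f := @CMap _ _ X Y (fun k => RepMap (@rE k)) dE.
have rE' k (i j : 'I_n) (e : j = i.+1 :> nat) :
    rmap (Y k) e *m idmx K (Y k j) (X k j) = idmx K (Y k i) (X k i) *m rmap (X k) e.
  rewrite -[LHS]mul1mx -(idmxK _ (esym (dimE k i))) -mulmxA [X in _ *m X]mulmxA -rE.
  by rewrite -mulmxA idmxK // mulmx1.
have dE' k i :
    cd Y k i *m idmx K (Y (k + 1) i) (X (k + 1) i) = idmx K (Y k i) (X k i) *m cd X k i.
  rewrite -[LHS]mul1mx -(idmxK _ (esym (dimE k i))) -mulmxA [X in _ *m X]mulmxA -dE.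
  by rewrite -mulmxA idmxK // mulmx1.
pose g := @CMap _ _ Y X (fun k => RepMap (@rE' k)) dE'.
exists (Db_map f), (Db_map g); rewrite -!Db_mapM.
by split; congr Db_map; apply: cmap_eq => k i /=; rewrite idmxK.
Qed.
End SameDimensions.

(** Both the simple and the indecomposable projective modules have this shape;
    the multiplicity d serves to exhaust a coordinate space of dimension d. *)
Program Definition box (k0 : int) (p : pred 'I_n) (d : nat) : cpx :=
  @Cpx K n (fun k => @Rep K n (fun i => mask_dim ((k == k0) && p i) d)
             (fun i j _ => mask_mx ((k == k0) && p i) ((k == k0) && p j) 1%:M))
    (fun k => @RepMap _ _ _ _ (fun i => 0) _) _ _.
Next Obligation. by move=> *; rewrite /= mul0mx mulmx0. Qed.
Next Obligation. by move=> *; rewrite /= mul0mx. Qed.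
Next Obligation.
move=> k0 p d; exists `|k0|%N => k i /= hk.
by have [e|//] := eqVneq k k0; move: hk; rewrite e ltnn.
Qed.

Definition simple_stalk (k : int) (i : 'I_n) := box k (pred1 i) 1.
Definition proj_stalk (k : int) (j : 'I_n) := box k (fun i : 'I_n => (j <= i)%N) 1.

(** Numbers the pairs (degree, vertex) so that differentials and arrows both
    increase the number.  The part of a complex in slots at least t is then a
    subcomplex, for every t. *)
Definition slot (k : int) (i : 'I_n) : int := k * n%:Z + i%:Z.

Lemma slot_inj k k' i i' : slot k i = slot k' i' -> k = k' /\ i = i'.
Proof.
rewrite /slot => h; have hi := ltn_ord i; have hi' := ltn_ord i'.
have ek : k = k'.
  have [lt_k|lt_k|//] := ltgtP k k'.
    have : 0 <= (k' - k - 1) * n%:Z by apply: mulr_ge0; lia.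
    by rewrite !mulrBl; lia.
  have : 0 <= (k - k' - 1) * n%:Z by apply: mulr_ge0; lia.
  by rewrite !mulrBl; lia.
by split=> //; apply: val_inj; move: h => /=; rewrite ek; lia.
Qed.

Section Mask.
Variable X : cpx.

Definition in_window (t t' : int) k i := ((t <= slot k i) && (slot k i < t'))%R.

Lemma slot_next_degree k i : slot (k + 1) i = slot k i + n%:Z.
Proof. by rewrite /slot mulrDl mul1r addrAC. Qed.

Lemma slot_next_vertex k (i j : 'I_n) : j = i.+1 :> nat -> slot k j = slot k i + 1.
Proof. by move=> e; rewrite /slot e; lia. Qed.

(** The subquotient of X that lives in the slots from t to t' - 1. *)
Program Definition window (t t' : int) : cpx :=
  @Cpx K n (fun k => @Rep K n (fun i => mask_dim (in_window t t' k i) (X k i))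
             (fun i j e =>
                mask_mx (in_window t t' k i) (in_window t t' k j) (rmap (X k) e)))
    (fun k => @RepMap _ _ _ _
       (fun i => mask_mx (in_window t t' k i) (in_window t t' (k + 1) i) (cd X k i)) _)
    _ _.
Next Obligation.
move=> t t' k i j e /=.
by rewrite !mask_mx_mul ?rmx_comm // /in_window !slot_next_degree (slot_next_vertex _ e);
  lia.
Qed.
Next Obligation.
move=> t t' k i /=; rewrite mask_mx_mul; last by rewrite /in_window !slot_next_degree; lia.
by rewrite cd_cd /mask_mx mulmx0 mul0mx.
Qed.
Next Obligation.
move=> t t'; have [N hN] := cbounded X; exists N => k i /hN /= ->.
by rewrite /mask_dim; case: ifP.
Qed.

(** For s = t this is the quotient map onto the lower slots, and for s' = t' the
    inclusion of the upper ones. *)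
Program Definition window_map (s s' t t' : int)
    (h1 : s >= t) (h2 : s' >= t') (h3 : s <= t') : cmap (window s s') (window t t') :=
  @CMap _ _ (window s s') (window t t')
    (fun k => @RepMap _ _ _ _
       (fun i => mask_mx (in_window s s' k i) (in_window t t' k i) 1%:M) _) _.
Next Obligation.
move=> s s' t t' h1 h2 h3 k i j e /=.
by rewrite !mask_mx_mul ?mulmx1 ?mul1mx // /in_window (slot_next_vertex _ e); lia.
Qed.
Next Obligation.
move=> s s' t t' h1 h2 h3 k i /=.
by rewrite !mask_mx_mul ?mulmx1 ?mul1mx // /in_window !slot_next_degree; lia.
Qed.

Lemma window_exact (t s t' : int) (h1 : t <= s) (h2 : s <= t') :
  pointwise_exact (window_map h1 (lexx t') h2) (window_map (lexx t) h2 h1).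
Proof.
move=> k i.
exists (mask_mx (in_window t t' k i) (in_window s t' k i) 1%:M),
  (mask_mx (in_window t s k i) (in_window t t' k i) 1%:M).
split=> /=.
- by rewrite mask_mx_mul ?mulmx1 ?mask_mx_id // /in_window; lia.
- by rewrite mask_mx_mul ?mulmx1 ?mask_mx_id // /in_window; lia.
- by rewrite mask_mx_mul ?mulmx1 ?mask_mx_false // /in_window; lia.
- by rewrite mask_mx_split // /in_window; lia.
Qed.

Lemma window_all :
  exists t (m : nat) (f : hom (X : Db) (window t (t + m%:Z) : Db)), is_iso f.
Proof.
have [N hN] := cbounded X.
exists (- (N * n)%:Z), ((N + N).+1 * n)%N.
have dimE k i : X k i = window (- (N * n)%:Z) (- (N * n)%:Z + ((N + N).+1 * n)%N%:Z) k i.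
  rewrite /= /mask_dim; case: ifPn => // hk; apply: hN.
  apply: contraR hk; rewrite -leqNgt /in_window /slot => hk.
  have hi := ltn_ord i; apply/andP; split; nia.
by apply: same_dim_iso => [|k i j e|k i]; rewrite ?dimE // /= /mask_mx !mulmxA idmxK
  ?mul1mx.
Qed.
End Mask.

Lemma same_dim_iso0 X Y : (forall k i, X k i = Y k i :> nat) ->
  (forall k (i j : 'I_n) (e : j = i.+1 :> nat), rmap (X k) e = 0) ->
  (forall k (i j : 'I_n) (e : j = i.+1 :> nat), rmap (Y k) e = 0) ->
  (forall k i, cd X k i = 0) -> (forall k i, cd Y k i = 0) ->
  exists f : hom (X : Db) (Y : Db), is_iso f.
Proof.
by move=> dimE rX rY dX dY; apply: same_dim_iso => // *;
  rewrite ?rX ?rY ?dX ?dY mulmx0 mul0mx.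
Qed.

Lemma box_shift k p d :
  exists f : hom (cshift (box (k + 1) p d) : Db) (box k p d : Db), is_iso f.
Proof.
apply: same_dim_iso => [l i|l i j e|l i] /=; rewrite ?oppr0 ?mulmx0 ?mul0mx //.
all: by rewrite (inj_eq (addIr _)) // !idmx1 mulmx1 mul1mx.
Qed.

Program Definition box_map k (p q : pred 'I_n) d1 d2 (A : 'M[K]_(d1, d2))
    (pq : forall i j : 'I_n, j = i.+1 :> nat -> p i -> q j -> p j && q i) :
    cmap (box k p d1) (box k q d2) :=
  @CMap _ _ (box k p d1) (box k q d2)
    (fun l => @RepMap _ _ _ _ (fun i => mask_mx ((l == k) && p i) ((l == k) && q i) A) _) _.
Next Obligation.
move=> k p q d1 d2 A pq l i j e /=.
by rewrite !mask_mx_mul ?mulmx1 ?mul1mx //; case: eqP => //= _ hp hq;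
  case/andP: (pq _ _ e hp hq).
Qed.
Next Obligation. by move=> *; rewrite /= mulmx0 mul0mx. Qed.

Section Vanishing.
Variables (G : zmodType) (L : Db -> G).
Hypothesis L_add : tri_additive Db_tri L.

(** The shift changes an additive function only by a sign. *)
Lemma additive_box_deg p d : (L (box 0 p d) = 0) -> forall k, L (box k p d) = 0.
Proof.
move=> L0.
have E k : L (box k p d) = - L (box (k + 1) p d).
  by have [f /(additive_iso L_add) <-] := box_shift k p d; rewrite (additive_shift L_add).
elim/int_rect => [//|m IH|m IH].
  by rewrite -[LHS]opprK intS addrC -E IH oppr0.
by rewrite E (_ : - m.+1%:Z + 1 = - m%:Z) ?IH ?oppr0 //; lia.
Qed.

(** A zero complex is an extension of itself by itself. *)
Lemma additive_zero X : (forall k i, X k i = 0%N :> nat) -> L X = 0.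
Proof.
move=> X0; apply: (addrI (L X)); rewrite addr0.
rewrite -(additive_exact L_add (f := cmap_id X) (g := cmap_id X)) //.
move=> k i; exists 1%:M, 1%:M; rewrite /= !mulmx1.
by split=> //; apply/matrixP => a; have := ltn_ord a; rewrite {2}X0.
Qed.

Lemma additive_box k p d : L (box k p 1) = 0 -> L (box k p d) = 0.
Proof.
move=> L1; elim: d => [|d IH].
  by apply: additive_zero => l i /=; rewrite /mask_dim; case: ifP.
have pp (i j : 'I_n) : j = i.+1 :> nat -> p i -> p j -> p j && p i by move=> _ -> ->.
pose f := box_map k (row_mx 1%:M 0 : 'M[K]_(1, 1 + d)) pp.
pose g := box_map k (col_mx 0 1%:M : 'M[K]_(1 + d, d)) pp.
rewrite (additive_exact L_add (f := f) (g := g)) ?L1 ?IH ?addr0 // => l i /=.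
exists (mask_mx _ _ (col_mx 1%:M 0)), (mask_mx _ _ (row_mx 0 1%:M)).
case: ((l == k) && p i); last by split; apply/matrixP => - [].
rewrite !mask_mx_true; split.
- by rewrite mul_row_col mul1mx mul0mx addr0.
- by rewrite mul_row_col mul1mx mul0mx add0r.
- by rewrite mul_row_col mulmx0 mul0mx addr0.
- rewrite !mul_col_row !mulmx0 !mul0mx !mul1mx add_block_mx !addr0 !add0r.
  by rewrite -scalar_mx_block.
Qed.

(** A single slot carries a sum of copies of one shifted simple module. *)
Lemma additive_window1 X t : (0 < n)%N -> (forall i, L (simple_stalk 0 i) = 0) ->
  L (window X t (t + 1)) = 0.
Proof.
move=> n0 L0; have n0' : n%:Z != 0 by lia.
have lt_i : (`|(t %% n%:Z)%Z| < n)%N.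
  by have := modz_ge0 t n0'; have := @ltz_pmod t n%:Z; lia.
pose i0 := Ordinal lt_i; pose k0 := (t %/ n%:Z)%Z.
have tE : t = slot k0 i0.
  by rewrite /slot /= gez0_abs ?modz_ge0 // -divz_eq.
have in_windowE k i : in_window t (t + 1) k i = (k == k0) && pred1 i0 i.
  rewrite /in_window tE /slot; have hi := ltn_ord i; have hi0 := ltn_ord i0; apply/idP/idP.
    move=> h; have [|-> ->] := @slot_inj k k0 i i0; last by rewrite /= !eqxx.
    by rewrite /slot; lia.
  by case/andP => /eqP -> /eqP ->; rewrite lexx ltrDl ltr01.
have [f /(additive_iso L_add) ->] :
    exists f : hom (window X t (t + 1) : Db) (box k0 (pred1 i0) (X k0 i0) : Db), is_iso f.
  apply: same_dim_iso0 => [k i|k i j e|k i j e|k i|k i] //=.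
  - by rewrite in_windowE /mask_dim /=; case: ifP => // /andP [/eqP -> /eqP ->].
  - rewrite mask_mx_false // !in_windowE /=.
    apply/negP => /andP [/andP [_ /eqP hi] /andP [_ /eqP hj]].
    by move: e; rewrite hi hj; lia.
  - rewrite mask_mx_false //; apply/negP => /andP [/andP [_ /eqP hi] /andP [_ /eqP hj]].
    by move: e; rewrite hi hj; lia.
  - by rewrite mask_mx_false // !in_windowE; lia.
by apply: additive_box; apply: additive_box_deg; exact: L0.
Qed.

(** The windows grow one slot at a time, and all of X lives in a bounded window. *)
Lemma additive_vanish_simple X : (0 < n)%N -> (forall i, L (simple_stalk 0 i) = 0) ->
  L X = 0.
Proof.
move=> n0 L0; have [t [m [f /(additive_iso L_add) ->]]] := window_all X.
elim: m {f} => [|m IH].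
  rewrite addr0; apply: (addrI (L (window X t t))).
  by rewrite addr0 -(additive_exact L_add (@window_exact X t t t (lexx t) (lexx t))).
have h1 : t <= t + m%:Z by lia.
have h2 : t + m%:Z <= t + m.+1%:Z by lia.
rewrite (additive_exact L_add (@window_exact X t _ _ h1 h2)) IH addr0.
by rewrite (_ : t + m.+1%:Z = t + m%:Z + 1) ?additive_window1 //; lia.
Qed.

(** The simple module at i is the cokernel of P_(i+1) -> P_i, and at the last
    vertex it is itself projective. *)
Lemma additive_vanish_proj X : (0 < n)%N -> (forall i, L (proj_stalk 0 i) = 0) -> L X = 0.
Proof.
move=> n0 L0; apply: additive_vanish_simple => // i.
have [lt_i|ge_i] := ltnP i.+1 n; last first.
  rewrite -[RHS](L0 i) /simple_stalk /proj_stalk; congr (L (box _ _ _)); apply: funext => j.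
  by rewrite /= -val_eqE /=; have := ltn_ord j; lia.
pose i' := Ordinal lt_i.
have p1 (a b : 'I_n) : b = a.+1 :> nat -> (i' <= a)%N -> (i <= b)%N ->
  (i' <= b)%N && (i <= a)%N.
  by rewrite /=; lia.
have p2 (a b : 'I_n) : b = a.+1 :> nat -> (i <= a)%N -> pred1 i b ->
  (i <= b)%N && pred1 i a.
  by rewrite /= -!val_eqE /=; lia.
have := additive_exact L_add
  (f := box_map 0 (1%:M : 'M[K]_1) p1) (g := box_map 0 (1%:M : 'M[K]_1) p2).
rewrite -/(proj_stalk 0 i) -/(proj_stalk 0 i') !L0 add0r => <- // k j /=.
have -> : (j == i) = (j == i :> nat) by [].
exists (mask_mx _ _ 1%:M), (mask_mx _ _ 1%:M); split.
- by rewrite mask_mx_mul ?mulmx1 ?mask_mx_id //; lia.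
- by rewrite mask_mx_mul ?mulmx1 ?mask_mx_id //; lia.
- by rewrite mask_mx_mul ?mulmx1 ?mask_mx_false //; lia.
- by rewrite mask_mx_split //; lia.
Qed.
End Vanishing.
End Complexes.

(** * Dimensions of morphism spaces and perfect pairings *)
Section Dimension.
Variable K : fieldType.
Implicit Types V W : lmodType K.

Definition lin V W (t : V -> W) := forall a u v, t (a *: u + v) = a *: t u + t v.

Lemma lin0 V W (t : V -> W) : lin t -> t 0 = 0.
Proof.
by move=> tl; have := tl (-1) 0 0; rewrite scaleN1r oppr0 addr0 scaleN1r addNr.
Qed.

Lemma lin_sum V W (t : V -> W) d (c : 'I_d -> K) (b : 'I_d -> V) :
  lin t -> t (\sum_i c i *: b i) = \sum_i c i *: t (b i).
Proof.
move=> tl; apply: (big_ind2 (fun x y => t x = y)); first exact: lin0.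
  by move=> x1 x2 y1 y2 <- <-; have := tl 1 x1 y1; rewrite !scale1r.
by move=> i _; have := tl (c i) (b i) 0; rewrite addr0 lin0 // addr0.
Qed.

(** Morphism spaces are not vector spaces with a chosen basis, so finite
    dimension is witnessed by linear coordinates. *)
Definition has_dim V d :=
  exists theta : V -> 'rV[K]_d,
    [/\ lin theta, injective theta & forall c, exists v, theta v = c].

Lemma has_dim_param V d (phi : 'rV[K]_d -> V) :
  lin phi -> injective phi -> (forall v, exists c, phi c = v) -> has_dim V d.
Proof.
move=> lin inj surj; have [theta tK] := choice surj.
exists theta; split=> [a u v|u v e|c].
- by apply: inj; rewrite lin !tK.
- by rewrite -(tK u) e tK.
- by exists (phi c); apply: inj; rewrite tK.
Qed.

Lemma has_dim_bij V W d (phi : V -> W) :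
  lin phi -> injective phi -> (forall w, exists v, phi v = w) ->
  has_dim W d -> has_dim V d.
Proof.
move=> lin inj surj [th [tl ti ts]].
exists (th \o phi); split=> [a u v|u v /ti /inj //|c] /=; first by rewrite lin tl.
by have [w <-] := ts c; have [v <-] := surj w; exists v.
Qed.

Lemma has_dim_le V d d' : has_dim V d -> has_dim V d' -> (d <= d')%N.
Proof.
move=> [th [tl ti ts]] [th' [tl' ti' ts']].
have /choice [b bE] : forall i : 'I_d, exists v, th v = delta_mx 0 i.
  by move=> i; exact: ts.
pose A := \matrix_(i < d) th' (b i).
have : row_free A.
  rewrite -kermx_eq0; apply/eqP/row_matrixP => r.
  rewrite row0; set c := row r _.
  have cA : c *m A = 0 by rewrite -row_mul mulmx_ker row0.
  have v0 : \sum_i c 0 i *: b i = 0.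
    apply: ti'; rewrite lin0 // lin_sum // -[RHS]cA mulmx_sum_row.
    by apply: eq_bigr => i _; rewrite rowK.
  have := congr1 th v0; rewrite lin0 // lin_sum // => <-.
  by rewrite [LHS]row_sum_delta; apply: eq_bigr => i _; rewrite bE.
by rewrite /row_free => /eqP <-; exact: rank_leq_col.
Qed.

Lemma has_dim_unique V d d' : has_dim V d -> has_dim V d' -> d = d'.
Proof.
by move=> h h'; apply/eqP; rewrite eqn_leq (has_dim_le h h') (has_dim_le h' h).
Qed.

(** Over a basis b of V, the coordinates of w are the values s (b i) w, and
    perfectness says that every family of values occurs exactly once. *)
Lemma has_dim_dual V W d (s : V -> W -> K^o) :
  (forall w, lin (s^~ w)) -> (forall v, lin (s v)) ->
  (forall phi : {linear V -> K^o}, exists! w, forall v, s v w = phi v) ->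
  has_dim V d -> has_dim W d.
Proof.
move=> sl sr perf [th [tl ti ts]].
have /choice [b bE] : forall i : 'I_d, exists v, th v = delta_mx 0 i.
  by move=> i; exact: ts.
have vE v : v = \sum_i th v 0 i *: b i.
  apply: ti; rewrite lin_sum // [LHS]row_sum_delta.
  by apply: eq_bigr => i _; rewrite bE.
exists (fun w => \row_i s (b i) w); split=> [a w w'|w w' e|c].
- by apply/rowP => i; rewrite !mxE sr.
- have eb i : s (b i) w = s (b i) w' by have /rowP/(_ i) := e; rewrite !mxE.
  pose F : {linear V -> K^o} :=
    HB.pack (s^~ w : V -> K^o) (GRing.isLinear.Build _ _ _ _ _ (sl w)).
  have [w0 [_ uniq]] := perf F.
  rewrite -(uniq w) //; apply: uniq => v /=.
  rewrite [in LHS](vE v) [in RHS](vE v) (lin_sum _ _ (sl w)) (lin_sum _ _ (sl w')).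
  by apply: eq_bigr => i _; rewrite eb.
- pose f v : K^o := \sum_i th v 0 i * c 0 i.
  have fl : linear f.
    move=> a u v; rewrite /f tl scaler_sumr -big_split /=; apply: eq_bigr => i _.
    by rewrite !mxE mulrDl -mulrA.
  pose F : {linear V -> K^o} := HB.pack f (GRing.isLinear.Build _ _ _ _ _ fl).
  have [w [wE _]] := perf F; exists w; apply/rowP => i; rewrite mxE wE /= /f bE.
  rewrite (bigD1 i) //= big1 ?addr0 ?mxE ?eqxx ?mul1r // => l /negPf li.
  by rewrite mxE li andbF mul0r.
Qed.

End Dimension.

(** * Maps from a projective are cohomology classes *)
Section Paths.
Variables (K : fieldType) (n : nat).
Implicit Types M N : rep K n.

Fixpoint path_nat M (j : 'I_n) m : forall h : (m < n)%N, 'M[K]_(M j, M (Ordinal h)) :=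
  match m with
  | 0 => fun h => if j == Ordinal h then idmx K _ _ else 0
  | m'.+1 => fun h => if j == Ordinal h then idmx K _ _ else
      path_nat M j (ltnW h) *m
      @rmap K n M (Ordinal (ltnW h)) (Ordinal h) erefl
  end.

(** The action of the path from j to i, built arrow by arrow; it is zero for
    i < j. *)
Definition path_mx M (j i : 'I_n) : 'M[K]_(M j, M i) :=
  let: Ordinal m h := i return 'M[K]_(M j, M i) in path_nat M j h.

Lemma path_mx_id M j : path_mx M j j = 1%:M.
Proof. by case: j => -[|m] h /=; rewrite ?eqxx idmx1. Qed.

Lemma path_mx_next M (j i i' : 'I_n) (e : i' = i.+1 :> nat) :
  j != i' -> path_mx M j i' = path_mx M j i *m rmap M e.
Proof.
case: i i' e => i hi [[|i'] hi'] //= e ne; have e' : i' = i by case: e.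
subst i'; rewrite (negPf ne) (bool_irrelevance (ltnW hi') hi).
by congr (_ *m rmap _ _); exact: Prop_irrelevance.
Qed.

Lemma path_mx_natural M N (f : repmap M N) j i :
  path_mx M j i *m f i = f j *m path_mx N j i.
Proof.
case: i => m h /=; elim: m h => [|m IH] h /=; case: (j =P _) => [->|_];
  rewrite ?idmx1 ?mulmx1 ?mul1mx ?mul0mx ?mulmx0 //.
by rewrite -mulmxA rmx_comm mulmxA IH mulmxA.
Qed.

End Paths.

Section Yoneda.
Variables (K : fieldType) (n : nat) (k : int) (j : 'I_n).
Local Notation cpx := (cpx K n).
Local Notation Db := (Db K n).
Implicit Types X Y Z : cpx.
Local Notation P := (proj_stalk K (k + 1) j).

(** The component at the vertex i of the map from P_j determined by the element
    x at j.  The space holding x has dimension d, propositionally equal to that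
    of M at j wherever b holds. *)
Definition spread_mx (b : bool) d (M : rep K n) (x : 'rV[K]_d) i :
  'M[K]_(mask_dim b 1, M i) :=
  idmx K _ _ *m x *m idmx K _ _ *m path_mx M j i.

Lemma spread_mx_next (b b' : bool) d M (x : 'rV[K]_d) (i i' : 'I_n) (e : i' = i.+1 :> nat) :
  (b -> b' /\ j != i') ->
  mask_mx b b' 1%:M *m spread_mx b' M x i' = spread_mx b M x i *m rmap M e.
Proof.
case: b => [/(_ isT) [hb' ne]|_]; last by rewrite [LHS]flatmx0 [RHS]flatmx0.
by rewrite /spread_mx (path_mx_next _ e) // mulmxA hb' mask_mx_true mul1mx !mulmxA.
Qed.

Lemma proj_next b (i i' : 'I_n) : i' = i.+1 :> nat ->
  b && (j <= i)%N -> b && (j <= i')%N /\ j != i'.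
Proof. by rewrite -val_eqE /=; lia. Qed.

Lemma eq_mx_row0 m p (A B : 'M[K]_(m, p)) : m = 0%N -> A = B.
Proof. by move=> m0; apply/matrixP => a; have := ltn_ord a; rewrite {2}m0. Qed.

Section FromCycle.
Variables (X : cpx) (x : 'rV[K]_(X (k + 1) j)).
Hypothesis xcyc : is_cycle x.

Lemma cycle_map_rep l (i i' : 'I_n) (e : i' = i.+1 :> nat) :
  rmap (P l) e *m spread_mx ((l == k + 1) && (j <= i')%N) (X l) x i' =
  spread_mx ((l == k + 1) && (j <= i)%N) (X l) x i *m rmap (X l) e.
Proof.
exact: (spread_mx_next _ _ e (proj_next e)).
Qed.

Lemma cycle_map_comm l i :
  cd P l i *m spread_mx ((l + 1 == k + 1) && (j <= i)%N) (X (l + 1)) x i =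
  spread_mx ((l == k + 1) && (j <= i)%N) (X l) x i *m cd X l i.
Proof.
rewrite /= mul0mx; have [/andP [/eqP h _]|h] := boolP ((l == k + 1) && (j <= i)%N);
  last first.
  by apply: eq_mx_row0; rewrite /= ?(negPf h).
subst l; rewrite /spread_mx -mulmxA path_mx_natural idmx1 mulmx1 mulmxA.
by rewrite -[_ *m x *m _]mulmxA xcyc mulmx0 mul0mx.
Qed.

(** P_j is generated by one element at the vertex j, so chain maps from its
    shift to X are the cycles of X at j. *)
Definition cycle_map : cmap P X :=
  @CMap _ _ P X (fun l => RepMap (@cycle_map_rep l)) cycle_map_comm.

End FromCycle.

Definition gen : 'rV[K]_(P (k + 1) j) := idmx K 1 _.

Lemma gen_cycle : is_cycle gen.
Proof. by rewrite /is_cycle mulmx0. Qed.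

(** Paths out of j carry the generator to the generators of P_j at the later
    vertices. *)
Lemma gen_path (i : 'I_n) : (j <= i)%N ->
  gen *m path_mx (P (k + 1)) j i = idmx K 1 (P (k + 1) i).
Proof.
have mkE (b b' : bool) : b -> b' ->
    idmx K 1 (mask_dim b 1) *m mask_mx b b' (1%:M : 'M_1) = idmx K 1 (mask_dim b' 1).
  by case: b b' => [] [] // _ _; rewrite mask_mx_true mulmx1.
case: i => m h; elim: m h => [|m IH] h ji.
  have e : j = Ordinal h by apply: val_inj; move: ji => /=; lia.
  by rewrite -e path_mx_id mulmx1.
have [e|ne] := eqVneq j (Ordinal h); first by rewrite -e path_mx_id mulmx1.
have ji' : (j <= Ordinal (ltnW h))%N by move: ji ne; rewrite -val_eqE /=; lia.
rewrite (path_mx_next (i := Ordinal (ltnW h)) (i' := Ordinal h) _ erefl) // mulmxA IH //=.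
by rewrite mkE //= eqxx.
Qed.

Lemma gen_cycle_map X x (h : is_cycle x) : gen *m @cycle_map X x h (k + 1) j = x.
Proof.
rewrite /= /spread_mx path_mx_id idmx1 !mulmx1 mulmxA /gen /= .
have : (k + 1 == k + 1) && (j <= j)%N by rewrite eqxx leqnn.
by case: (_ && _) => // _; rewrite !idmx1 !mul1mx.
Qed.

Lemma cycle_map_gen : cycle_map gen_cycle = cmap_id P.
Proof.
apply: cmap_eq => l i; rewrite [LHS]/=.
have [/andP [/eqP e ji]|h] := orP (orbN ((l == k + 1) && (j <= i)%N)); last first.
  by apply: eq_mx_row0; rewrite /= ?(negPf h).
subst l; rewrite /spread_mx idmx1 mulmx1 -mulmxA gen_path //.
by apply: idmxK; rewrite /= eqxx ji.
Qed.

Lemma cycle_map_comp X Y (f : cmap X Y) x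
    (h : is_cycle x) (h' : is_cycle (x *m f (k + 1) j)) :
  cmap_comp f (cycle_map h) = cycle_map h'.
Proof.
apply: cmap_eq => l i /=; have [/andP [/eqP e _]|nb] :=
  boolP ((l == k + 1) && (j <= i)%N); last first.
  by apply: eq_mx_row0; rewrite /= ?(negPf nb).
by subst l; rewrite /spread_mx -mulmxA path_mx_natural !idmx1 !mulmx1 !mulmxA.
Qed.

Lemma cycle_map_add X (x y : 'rV_(X (k + 1) j))
    (hx : is_cycle x) (hy : is_cycle y) (h : is_cycle (x + y)) :
  cycle_map h = cmap_add (cycle_map hx) (cycle_map hy).
Proof. by apply: cmap_eq => l i /=; rewrite /spread_mx mulmxDr !mulmxDl. Qed.

Lemma cycle_map_scale X a (x : 'rV_(X (k + 1) j))
    (hx : is_cycle x) (h : is_cycle (a *: x)) :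
  cycle_map h = cmap_scale a (cycle_map hx).
Proof. by apply: cmap_eq => l i /=; rewrite /spread_mx -scalemxAr -!scalemxAl. Qed.

(** An element with boundary x spreads to a null-homotopy. *)
Lemma cycle_map_boundary X (x : 'rV_(X (k + 1) j)) (hx : is_cycle x) :
  is_boundary x -> Db_map (cycle_map hx) = 0 :> hom (P : Db) (X : Db).
Proof.
move=> [z xz].
have hr l (i i' : 'I_n) (e : i' = i.+1 :> nat) :
    rmap (P (l + 1)) e *m spread_mx ((l + 1 == k + 1) && (j <= i')%N) (X l) z i' =
    spread_mx ((l + 1 == k + 1) && (j <= i)%N) (X l) z i *m rmap (X l) e.
  exact: (spread_mx_next _ _ e (proj_next e)).
apply: (@null_homotopic K n P X (cycle_map hx) (fun l => RepMap (@hr l))) => l i /=.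
rewrite mul0mx addr0; have [/andP [/eqP /addIr e _]|h] :=
  boolP ((l + 1 == k + 1) && (j <= i)%N); last first.
  by apply: eq_mx_row0; rewrite /= ?(negPf h).
subst l.
by rewrite /spread_mx -[RHS]mulmxA path_mx_natural !idmx1 !mulmx1 xz !mulmxA.
Qed.

Section Action.

Definition homologous X (x y : 'rV_(X (k + 1) j)) := is_boundary (x - y).

Lemma boundaryP X (x : 'rV_(X (k + 1) j)) : is_boundary x <-> (x <= cd X k j)%MS.
Proof. by split=> [[z ->]|/submxP [z ->]]; [exact: submxMl | exists z]. Qed.

Lemma cycleP X (x : 'rV_(X (k + 1) j)) : is_cycle x <-> (x <= kermx (cd X (k + 1) j))%MS.
Proof. by split=> [h|/sub_kermxP]; [apply/sub_kermxP | ]. Qed.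

Lemma boundary0 X : is_boundary (0 : 'rV_(X (k + 1) j)).
Proof. by apply/boundaryP; exact: sub0mx. Qed.

Lemma boundaryD X (x y : 'rV_(X (k + 1) j)) : is_boundary x -> is_boundary y ->
  is_boundary (x + y).
Proof. by move=> /boundaryP hx /boundaryP hy; apply/boundaryP; exact: addmx_sub. Qed.

Lemma boundaryZ X a (x : 'rV_(X (k + 1) j)) : is_boundary x -> is_boundary (a *: x).
Proof. by move=> /boundaryP hx; apply/boundaryP; exact: scalemx_sub. Qed.

Lemma boundaryM X Y (f : cmap X Y) (x : 'rV_(X (k + 1) j)) :
  is_boundary x -> is_boundary (x *m f (k + 1) j).
Proof. by move=> [z ->]; exists (z *m f k j); rewrite -!mulmxA cmx_comm. Qed.

Lemma homologous_refl X (x : 'rV_(X (k + 1) j)) : homologous x x.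
Proof. by rewrite /homologous subrr; exact: boundary0. Qed.

Lemma homologous_sym X (x y : 'rV_(X (k + 1) j)) : homologous x y -> homologous y x.
Proof. by move=> /(boundaryZ (-1)); rewrite scaleN1r opprB. Qed.

Lemma homologous_trans X (y x z : 'rV_(X (k + 1) j)) : homologous x y -> homologous y z ->
  homologous x z.
Proof. by move=> h h'; have := boundaryD h h'; rewrite addrA subrK. Qed.

Lemma homologous_lin X a (x x' y y' : 'rV_(X (k + 1) j)) :
  homologous x x' -> homologous y y' -> homologous (a *: x + y) (a *: x' + y').
Proof.
move=> /(boundaryZ a) h h'; have := boundaryD h h'.
by rewrite /homologous scalerBr addrACA opprD.
Qed.

Lemma homologous_add X (x x' y y' : 'rV_(X (k + 1) j)) :
  homologous x x' -> homologous y y' -> homologous (x + y) (x' + y').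
Proof. by move=> h h'; have := homologous_lin 1 h h'; rewrite !scale1r. Qed.

Lemma cycle_lin X a (x y : 'rV_(X (k + 1) j)) : is_cycle x -> is_cycle y ->
  is_cycle (a *: x + y).
Proof. by rewrite /is_cycle mulmxDl -scalemxAl => -> ->; rewrite scaler0 addr0. Qed.

Lemma cycleM X Y (f : cmap X Y) (x : 'rV_(X (k + 1) j)) : is_cycle x ->
  is_cycle (x *m f (k + 1) j).
Proof. by rewrite /is_cycle -mulmxA -cmx_comm mulmxA => ->; rewrite mul0mx. Qed.

(** The inverse of a quasi-isomorphism on cohomology, as a choice of cycles. *)
Definition quasi_iso_lift X Y (q : cmap X Y) (y : 'rV_(Y (k + 1) j)) : 'rV_(X (k + 1) j) :=
  xget 0 [set x | is_cycle x /\ homologous y (x *m q (k + 1) j)]%classic.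

Lemma quasi_iso_liftP X Y (q : cmap X Y) y : quasi_iso q -> is_cycle y ->
  is_cycle (quasi_iso_lift q y) /\ homologous y (quasi_iso_lift q y *m q (k + 1) j).
Proof.
move=> qi cy; have [_ /(_ y cy) [x cx hx]] := qi k j.
by apply: (@xgetPex _ 0 [set x | is_cycle x /\ homologous y (x *m q (k + 1) j)]%classic);
  exists x.
Qed.

Lemma quasi_iso_inj X Y (q : cmap X Y) (x x' : 'rV_(X (k + 1) j)) : quasi_iso q ->
  is_cycle x -> is_cycle x' -> homologous (x *m q (k + 1) j) (x' *m q (k + 1) j) ->
    homologous x x'.
Proof.
move=> qi cx cx'; rewrite /homologous -mulmxBl => h; have [+ _] := qi k j; apply=> //.
by have := cycle_lin (-1) cx' cx; rewrite scaleN1r addrC.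
Qed.

(** The action on cohomology, defined on the generators of the localization; it
    is well defined and linear only modulo boundaries. *)
Fixpoint coh_act X Y (s : dterm X Y) : 'rV[K]_(X (k + 1) j) -> 'rV[K]_(Y (k + 1) j) :=
  match s with
  | Dmap _ _ f => fun x => x *m f (k + 1) j
  | Dinv _ _ q _ => quasi_iso_lift q
  | Dcomp _ _ _ s t => fun x => coh_act s (coh_act t x)
  | Dadd _ _ s t => fun x => coh_act s x + coh_act t x
  | Dscale _ _ a s => fun x => a *: coh_act s x
  end.

Lemma coh_act_cycle X Y (s : dterm X Y) x : is_cycle x -> is_cycle (coh_act s x).
Proof.
elim: s x => {X Y} [X Y f|X Y q qi|X Y Z s IHs t IHt|X Y s IHs t IHt|X Y a s IHs] x cx /=.
- exact: cycleM.
- by have [] := quasi_iso_liftP qi cx.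
- by apply: IHs; exact: IHt.
- by have := cycle_lin 1 (IHs _ cx) (IHt _ cx); rewrite scale1r.
- by rewrite /is_cycle -scalemxAl IHs // scaler0.
Qed.

Lemma coh_act_homologous X Y (s : dterm X Y) x y : is_cycle x -> is_cycle y ->
  homologous x y -> homologous (coh_act s x) (coh_act s y).
Proof.
elim: s x y => {X Y} [X Y f|X Y q qi|X Y Z s IHs t IHt|X Y s IHs t IHt|X Y a s IHs] x y cx
  cy xy /=.
- by rewrite /homologous -mulmxBl; exact: boundaryM.
- have [c1 h1] := quasi_iso_liftP qi cx; have [c2 h2] := quasi_iso_liftP qi cy.
  by apply: (quasi_iso_inj qi) => //; apply: homologous_trans h2;
    apply: homologous_trans xy; exact: homologous_sym.
- by apply: IHs; [exact: coh_act_cycle .. | exact: IHt].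
- by apply: homologous_add; [exact: IHs | exact: IHt].
- by rewrite /homologous -scalerBr; apply: boundaryZ; exact: IHs.
Qed.

Lemma coh_act_lin X Y (s : dterm X Y) a x y : is_cycle x -> is_cycle y ->
  homologous (coh_act s (a *: x + y)) (a *: coh_act s x + coh_act s y).
Proof.
elim: s a x y => {X Y} [X Y f|X Y q qi|X Y Z s IHs t IHt|X Y s IHs t IHt|X Y b s IHs] a x
  y cx cy /=.
- by rewrite mulmxDl -scalemxAl; exact: homologous_refl.
- have [c1 h1] := quasi_iso_liftP qi cx; have [c2 h2] := quasi_iso_liftP qi cy.
  have [c3 h3] := quasi_iso_liftP qi (cycle_lin a cx cy).
  apply: (quasi_iso_inj qi) => //; first exact: cycle_lin.
  apply: homologous_trans (homologous_sym h3) _; rewrite mulmxDl -scalemxAl;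
    exact: homologous_lin.
- apply: homologous_trans (IHs _ _ _ _ _); try exact: coh_act_cycle.
  apply: coh_act_homologous; last exact: IHt.
  + by apply: coh_act_cycle; exact: cycle_lin.
  + by apply: cycle_lin; exact: coh_act_cycle.
- have := homologous_add (IHs a x y cx cy) (IHt a x y cx cy).
  by rewrite addrACA scalerDr.
- have := boundaryZ b (IHs a x y cx cy).
  by rewrite /homologous scalerBr scalerDr !scalerA mulrC.
Qed.

(** Cohomology is a functor on the derived category. *)
Lemma deq_coh_act X Y (s t : dterm X Y) : deq s t ->
  forall x, is_cycle x -> homologous (coh_act s x) (coh_act t x).
Proof.
elim=> {X Y s t}.
- by move=> *; exact: homologous_refl.
- by move=> X Y s t _ IH x cx; apply: homologous_sym; exact: IH.
- by move=> X Y s t u _ IH _ IH' x cx; apply: homologous_trans (IH x cx) (IH' x cx).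
- move=> X Y Z s s' t t' _ IH _ IH' x cx /=.
  apply: homologous_trans (IH _ (coh_act_cycle _ cx)).
  by apply: coh_act_homologous (IH' x cx); exact: coh_act_cycle.
- by move=> X Y s s' t t' _ IH _ IH' x cx /=; apply: homologous_add;
  [exact: IH | exact: IH'].
- by move=> X Y a s s' _ IH x cx /=; rewrite /homologous -scalerBr; apply: boundaryZ;
  exact: IH.
- by move=> X Y s t u x _ /=; rewrite addrA; exact: homologous_refl.
- by move=> X Y s t x _ /=; rewrite addrC; exact: homologous_refl.
- by move=> X Y s x _ /=; rewrite mulmx0 add0r; exact: homologous_refl.
- by move=> X Y s x _ /=; rewrite mulmx0 scaleN1r addNr; exact: homologous_refl.
- by move=> X Y a b s x _ /=; rewrite scalerA; exact: homologous_refl.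
- by move=> X Y s x _ /=; rewrite scale1r; exact: homologous_refl.
- by move=> X Y a s t x _ /=; rewrite scalerDr; exact: homologous_refl.
- by move=> X Y a b s x _ /=; rewrite scalerDl; exact: homologous_refl.
- by move=> *; exact: homologous_refl.
- by move=> X Y s x _ /=; rewrite mulmx1; exact: homologous_refl.
- by move=> X Y s x _ /=; rewrite mulmx1; exact: homologous_refl.
- by move=> *; exact: homologous_refl.
- by move=> X Y Z a s t t' x cx /=; apply: coh_act_lin; exact: coh_act_cycle.
- by move=> X Y Z g f x _ /=; rewrite mulmxA; exact: homologous_refl.
- by move=> X Y f g x _ /=; rewrite mulmxDr; exact: homologous_refl.
- by move=> X Y a f x _ /=; rewrite scalemxAr; exact: homologous_refl.
- move=> X Y q qi x cx /=; have [c h] := quasi_iso_liftP qi (cycleM q cx).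
  by rewrite mulmx1; apply: (quasi_iso_inj qi) => //; exact: homologous_sym.
- move=> X Y q qi x cx /=; have [c h] := quasi_iso_liftP qi cx.
  by rewrite mulmx1; exact: homologous_sym.
Qed.

Lemma cycle_map_homologous X (x y : 'rV_(X (k + 1) j)) (hx : is_cycle x) (hy : is_cycle y) :
  homologous x y -> Db_map (cycle_map hx) = Db_map (cycle_map hy) :> hom (P : Db) (X : Db).
Proof.
move=> h; have c : is_cycle (x - y) by have := cycle_lin (-1) hy hx; rewrite scaleN1r addrC.
have hx' : is_cycle ((x - y) + y) by rewrite subrK.
have -> : cycle_map hx = cycle_map hx' by apply: cmap_eq => l i /=; rewrite subrK.
by rewrite (cycle_map_add c hy) Db_mapD cycle_map_boundary // add0r.
Qed.

(** Composition with a morphism of the derived category turns the map of a cycle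
    into the map of its image.  For a formal inverse of q this holds because q
    carries the lifted cycle to a homologous one. *)
Lemma cycle_map_act X Y (s : dterm X Y) x (hx : is_cycle x) (h : is_cycle (coh_act s x)) :
  (dcls s : hom (X : Db) (Y : Db)) \c Db_map (cycle_map hx) = Db_map (cycle_map h).
Proof.
elim: s x hx h => {X Y} [X Y f|X Y q qi|X Y Z s IHs t IHt|X Y s IHs t IHt|X Y a s IHs] x
  hx h /=.
- by rewrite -/(Db_map f) -[dcomp _ _]Db_mapM; congr Db_map; exact: cycle_map_comp.
- have [c hl] := quasi_iso_liftP qi hx; have [g [gq qg]] := quasi_iso_is_iso qi.
  have -> : dcomp (dcls (Dinv qi)) (Db_map (cycle_map hx)) =
     dcomp (dcls (Dinv qi)) (Db_map (cycle_map (cycleM q h))).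
    by congr dcomp; exact: cycle_map_homologous.
  rewrite -(cycle_map_comp h (cycleM q h)) Db_mapM /= dcompA [X in dcomp X _]dcompE.
  have -> : dcls (Dcomp (Dinv qi) (Dmap q)) = idm (X : Db) by apply/dclsP; exact: deq_invl.
  exact: dcomp1m.
- rewrite -dcompE -dcompA; have ht := coh_act_cycle t hx.
  by rewrite [X in dcomp _ X](IHt _ _ ht) [LHS]IHs.
- rewrite -daddE; have hs := coh_act_cycle s hx; have ht := coh_act_cycle t hx.
  transitivity ((dcls s : hom (X : Db) (Y : Db)) \c Db_map (cycle_map hx) +
                (dcls t : hom (X : Db) (Y : Db)) \c Db_map (cycle_map hx)).
    exact: (@compDl _ Db).
  rewrite (IHs _ hx hs) (IHt _ hx ht) -Db_mapD.
  by congr Db_map; rewrite -cycle_map_add.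
- rewrite -dscaleE; have hs := coh_act_cycle s hx.
  have := @compPl _ Db _ _ _ a (dcls s : hom (X : Db) (Y : Db)) 0 (Db_map (cycle_map hx)).
  rewrite addr0 comp0m addr0 => E; rewrite (IHs _ hx hs) -Db_mapZ in E; rewrite [LHS]E.
  by congr Db_map; rewrite -cycle_map_scale.
Qed.

(** Every morphism out of the projective is its composite with the identity, the
    map of the generating cycle. *)
Lemma hom_proj_surj X (u : hom (P : Db) (X : Db)) :
  exists (x : 'rV_(X (k + 1) j)) (h : is_cycle x), u = Db_map (cycle_map h).
Proof.
have h := coh_act_cycle (drepr u) gen_cycle; exists (coh_act (drepr u) gen), h.
by rewrite -(cycle_map_act gen_cycle) cycle_map_gen Db_map1 compm1 dreprK.
Qed.

Lemma cycle_map_eq0 X (x : 'rV_(X (k + 1) j)) (h : is_cycle x) :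
  Db_map (cycle_map h) = 0 :> hom (P : Db) (X : Db) -> is_boundary x.
Proof.
move=> /dclsP /deq_coh_act /(_ gen gen_cycle); rewrite [coh_act _ _]gen_cycle_map /= mulmx0.
by rewrite /homologous subr0.
Qed.

End Action.

(** The dimension of H^(k+1)(X) at the vertex j: a complement of the boundaries
    in the cycles represents the cohomology. *)
Definition coh_dim X := \rank (kermx (cd X (k + 1) j) :\: cd X k j)%MS.

(** Sending the elements of the complement to their maps is onto, since
    homologous cycles have equal maps, and injective, since the map of a cycle
    that is not a boundary acts nontrivially on the generator. *)
Lemma hom_proj_dim X : has_dim (hom (P : Db) (X : Db)) (coh_dim X).
Proof.
set Q := (kermx (cd X (k + 1) j) :\: cd X k j)%MS.
pose r := row_base Q.
have rQ v : (v *m r <= Q)%MS by apply: submx_trans (submxMl _ _) _; rewrite eq_row_base.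
have cr v : is_cycle (v *m r).
  by apply/cycleP; apply: submx_trans (rQ _ v) (diffmxSl _ _).
pose phi v : hom (P : Db) (X : Db) := Db_map (cycle_map (cr v)).
have phi_lin a u v : phi (a *: u + v) = a *: phi u + phi v.
  have c1 : is_cycle (a *: (u *m r)) by rewrite scalemxAl.
  rewrite /phi -Db_mapZ -(cycle_map_scale (cr u) c1) -Db_mapD.
  have c2 : is_cycle (a *: (u *m r) + v *m r) by rewrite scalemxAl -mulmxDl.
  rewrite -(cycle_map_add c1 (cr v) c2); congr Db_map; apply: cmap_eq => l i /=.
  by rewrite mulmxDl -scalemxAl.
apply: (@has_dim_param _ _ _ phi) => // [u v e|w].
  have : phi (u - v) = 0.
    by rewrite -scaleN1r [_ + (_ *: _)]addrC phi_lin e scaleN1r addNr.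
  move=> /cycle_map_eq0 /boundaryP hb; apply/eqP; rewrite -subr_eq0; apply/eqP.
  have : ((u - v) *m r <= Q :&: cd X k j)%MS by rewrite sub_capmx rQ.
  rewrite capmx_diff submx0 => /eqP h0.
  by apply: (row_free_inj (row_base_free Q)); rewrite h0 mul0mx.
have [x [cx ->]] := hom_proj_surj w.
have : (x <= Q + (kermx (cd X (k + 1) j) :&: cd X k j))%MS.
  by rewrite addsmx_diff_cap_eq; exact/cycleP.
move=> /sub_addsmxP [[v u] /= xE].
have /submxP [c cE] : (v *m Q <= r)%MS.
  by apply: submx_trans (submxMl _ _) _; rewrite eq_row_base.
exists c; apply: cycle_map_homologous; rewrite /homologous -cE xE opprD addrA subrr sub0r.
rewrite -scaleN1r; apply: boundaryZ; apply/boundaryP.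
exact: submx_trans (submxMl _ _) (capmxSr _ _).
Qed.
End Yoneda.

(** * Dimension vectors and the Coxeter transformation *)
Section Totals.

Definition fin_supp (F : int -> int) := exists N : nat, forall k, (N < `|k|)%N -> F k = 0.
Definition int_sum (F : int -> int) : int := \sum_(k \in setT) F k.
Definition irange (N : nat) : seq int := [seq m%:Z - N%:Z | m <- iota 0 (N + N).+1].

Lemma irange_uniq N : uniq (irange N).
Proof. by rewrite map_inj_uniq ?iota_uniq // => a b; lia. Qed.

Lemma int_sum_range F (N : nat) : (forall k, (N < `|k|)%N -> F k = 0) ->
  int_sum F = \sum_(k <- irange N) F k.
Proof.
move=> hF; apply: fsum_seq; first exact: irange_uniq.
move=> k hk; apply: hF; rewrite ltnNge; apply: contra hk => hk.
by apply/mapP; exists (absz (k + N%:Z)); rewrite ?mem_iota; lia.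
Qed.

Lemma int_sum_eq F G : (forall k, F k = G k) -> int_sum F = int_sum G.
Proof. by move=> e; congr int_sum; exact: funext. Qed.

Lemma int_sumD F G : fin_supp F -> fin_supp G ->
  int_sum (fun k => F k + G k) = int_sum F + int_sum G.
Proof.
move=> [N hN] [M hM]; rewrite !(@int_sum_range _ (N + M)%N) ?big_split // => k hk;
  rewrite ?hN ?hM ?addr0 //; lia.
Qed.

Lemma int_sumN F : fin_supp F -> int_sum (fun k => - F k) = - int_sum F.
Proof.
move=> [N hN]; rewrite !(@int_sum_range _ N) //; last by move=> k /hN ->; rewrite oppr0.
by rewrite (big_morph _ (@opprD _) (@oppr0 _)).
Qed.

Lemma int_sum_shift F : int_sum (fun k => F (k + 1)) = int_sum F.
Proof.
rewrite /int_sum [RHS](@reindex_fsbigT _ _ _ _ _ (fun k : int => k + 1)) //.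
by exists (fun k => k - 1) => k; [rewrite addrK | rewrite subrK].
Qed.

Lemma int_sum_single F k0 : (forall k, k != k0 -> F k = 0) -> int_sum F = F k0.
Proof.
move=> h; rewrite /int_sum (@fsum_seq _ _ [:: k0]) ?big_seq1 // => k.
by rewrite inE => /h.
Qed.

Lemma fin_suppD F G : fin_supp F -> fin_supp G -> fin_supp (fun k => F k + G k).
Proof.
by move=> [N hN] [M hM]; exists (N + M)%N => k hk; rewrite hN ?hM ?addr0 //; lia.
Qed.

Lemma fin_suppN F : fin_supp F -> fin_supp (fun k => - F k).
Proof. by move=> [N hN]; exists N => k /hN ->; rewrite oppr0. Qed.

Lemma fin_supp_shift F : fin_supp F -> fin_supp (fun k => F (k + 1)).
Proof. by move=> [N hN]; exists N.+1 => k hk; apply: hN; lia. Qed.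

Definition deg_sign (k : int) : int := (-1) ^+ absz k.

Lemma deg_signS k : deg_sign (k + 1) = - deg_sign k.
Proof.
case: k => m; rewrite /deg_sign.
  by rewrite (_ : absz (m%:Z + 1) = m.+1) ?exprS ?mulN1r //; lia.
by rewrite NegzE (_ : absz (- m.+1%:Z + 1) = m) ?abszN ?exprS ?mulN1r ?opprK //; lia.
Qed.

End Totals.

Section Euler.
Variables (K : fieldType) (n : nat).
Local Notation cpx := (cpx K n).
Local Notation Db := (Db K n).
Local Notation Db_tri := (Db_tri K n).
Implicit Types X Y Z : cpx.

(** Composition with an isomorphism is a linear bijection on the morphisms out of
    a shifted projective. *)
Lemma coh_dim_iso k j X Y (f : hom (X : Db) (Y : Db)) : is_iso f ->
  coh_dim k j X = coh_dim k j Y.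
Proof.
move=> [g [gf fg]]; apply: has_dim_unique (hom_proj_dim k j X) _.
apply: has_dim_bij (hom_proj_dim k j Y) => [|u v e|w].
- exact: (fun a u v => @compPr _ Db _ _ _ a f u v).
- by rewrite -[u](@comp1m _ Db) -[v](@comp1m _ Db) -gf -!(@compA _ Db) e.
- by exists (g \c w); rewrite (@compA _ Db) fg (@comp1m _ Db).
Qed.

Lemma coh_dimD k j X :
  (coh_dim k j X + \rank (cd X k j) + \rank (cd X (k + 1)%R j))%N = X (k + 1)%R j.
Proof.
have h := mxrank_cap_compl (kermx (cd X (k + 1) j)) (cd X k j).
move: h; rewrite mxrank_ker (_ : \rank (kermx (cd X (k + 1) j) :&: cd X k j)%MS =
  \rank (cd X k j)).
  by rewrite /coh_dim [(\rank (cd X k j) + _)%N]addnC => ->; rewrite subnK // rank_leq_row.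
apply/eqmx_rank; rewrite capmxSr sub_capmx submx_refl andbT.
by apply/sub_kermxP; exact: cd_cd.
Qed.

Definition dimv X : 'rV[int]_n := \row_i int_sum (fun k => deg_sign k * (X k i)%:Z).

Lemma fin_dim X i : fin_supp (fun k => deg_sign k * (X k i)%:Z).
Proof. by have [N hN] := cbounded X; exists N => k /hN ->; rewrite mulr0. Qed.

Lemma fin_rank X i : fin_supp (fun k => deg_sign k * (\rank (cd X k i))%:Z).
Proof.
have [N hN] := cbounded X; exists N => k hk.
have -> : \rank (cd X k i) = 0%N; last by rewrite mulr0.
by apply/eqP; rewrite -leqn0 -(hN k i hk) rank_leq_row.
Qed.

(** The Euler characteristic is that of the cohomology: the ranks of two
    consecutive differentials enter with opposite signs and telescope.  The sign
    in front comes from [coh_dim k] being the cohomology in degree k + 1. *)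
Lemma dimv_coh X i : dimv X 0 i = - int_sum (fun k => deg_sign k * (coh_dim k i X)%:Z).
Proof.
set F := fun k : int => deg_sign k * (X k i)%:Z.
set R := fun k : int => deg_sign k * (\rank (cd X k i))%:Z.
have fF := fin_dim X i; have fR := fin_rank X i.
rewrite (@int_sum_eq _ (fun k => - F (k + 1) + (- R k + R (k + 1)))) => [|k]; last first.
  rewrite /F /R deg_signS (_ : (X (k + 1) i)%:Z =
    (coh_dim k i X)%:Z + (\rank (cd X k i))%:Z + (\rank (cd X (k + 1) i))%:Z).
    rewrite !mulNr !mulrDr opprK; lia.
  by rewrite -!PoszD; congr Posz; rewrite coh_dimD.
have fF' := fin_suppN (fin_supp_shift fF); have fR' := fin_suppN fR.
have fR1 := fin_supp_shift fR.
rewrite int_sumD //; last exact: fin_suppD.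
rewrite int_sumD // !int_sumN //; last exact: fin_supp_shift.
by rewrite !int_sum_shift addNr addr0 opprK mxE.
Qed.

Lemma dimv_iso X Y (f : hom (X : Db) (Y : Db)) : is_iso f -> dimv X = dimv Y.
Proof.
move=> h; apply/rowP => i; rewrite !dimv_coh; congr (- _); apply: int_sum_eq => k.
by rewrite (coh_dim_iso k i h).
Qed.

Lemma dimv_shift X : dimv (cshift X) = - dimv X.
Proof.
apply/rowP => i; rewrite !mxE -[in RHS]int_sum_shift -int_sumN; last first.
  exact: (fin_supp_shift (fin_dim X i)).
by apply: int_sum_eq => k /=; rewrite deg_signS mulNr opprK.
Qed.

(** The dimensions of a cone are those of the target and of the shifted source;
    isomorphism invariance covers the other triangles. *)
Lemma dimv_additive : tri_additive Db_tri (dimv : Db -> 'rV[int]_n).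
Proof.
move=> X Y Z u v w [A [B [f [a [b [c [[ha hb hc] _]]]]]]].
rewrite (dimv_iso ha) (dimv_iso hb) (dimv_iso hc) -[dimv A]opprK -dimv_shift.
apply/rowP => i; rewrite !mxE.
have fA : fin_supp (fun k => deg_sign k * (cshift A k i)%:Z) by exact: fin_dim.
rewrite -int_sumN // -int_sumD; [|exact: fin_suppN|exact: fin_dim].
by apply: int_sum_eq => k /=; rewrite PoszD mulrDr addKr.
Qed.

Lemma dimv_proj i j : dimv (proj_stalk K 0 i) 0 j = (i <= j)%N.
Proof.
rewrite mxE (@int_sum_single _ 0) /=; last by move=> k /negPf ->; rewrite mulr0.
by rewrite mul1r /mask_dim; case: leqP.
Qed.

Lemma dimv_simple i : dimv (simple_stalk K 0 i) = delta_mx 0 i.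
Proof.
apply/rowP => j.
rewrite !mxE (@int_sum_single _ 0) /=; last by move=> k /negPf ->; rewrite mulr0.
by rewrite mul1r /mask_dim; case: eqP.
Qed.

Variable tau : ar_translation Db_tri.

Lemma serre_dim X Y d : has_dim (hom (X : Db) (Y : Db)) d ->
  has_dim (hom (Y : Db) (susp Db_tri (tau X))) d.
Proof.
apply: (@has_dim_dual K _ _ d (@serre _ _ _ tau X Y)).
- by move=> w a u v; rewrite serre_linl.
- by move=> v a w w'; rewrite serre_linr.
- by move=> phi; exact: (serre_perfect tau phi).
Qed.

(** By Serre duality, maps from a shift of P_j to Sigma (tau P_i) are dual to maps
    from P_i to that shift of P_j.  They vanish outside degree 0, where they are
    the value of P_j at i. *)
Lemma dimv_tau_proj i j : dimv (tau (proj_stalk K 0 i)) 0 j = - ((j <= i)%N)%:Z.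
Proof.
rewrite -[LHS]opprK; congr (- _).
have -> : - dimv (tau (proj_stalk K 0 i)) 0 j = dimv (cshift (tau (proj_stalk K 0 i))) 0 j.
  by rewrite dimv_shift [RHS]mxE.
rewrite dimv_coh.
have cE l : coh_dim l j (cshift (tau (proj_stalk K 0 i))) = ((l == -1) && (j <= i)%N).
  (* Degree 0 is written -1 + 1, as [hom_proj_dim k] concerns degree k + 1. *)
  have h1 := hom_proj_dim (-1) i (proj_stalk K (l + 1) j).
  rewrite addNr in h1.
  rewrite (has_dim_unique (hom_proj_dim l j _) (serre_dim h1)).
  have := coh_dimD (-1) i (proj_stalk K (l + 1) j); rewrite /= !mxrank0 !addn0 => ->.
  by rewrite addNr /mask_dim; have -> : (0 == l + 1) = (l == -1); [lia | case: ifP].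
rewrite (@int_sum_single _ (-1)) => [|l /negPf ln]; last by rewrite cE ln mulr0.
by rewrite cE eqxx /deg_sign /= mulN1r opprK.
Qed.

(** Row i is the vector e_(i+1), and the last row is -(e_0 + ... + e_(n-1)). *)
Definition coxeter : 'M[int]_n :=
  \matrix_(i, j) ((j == i.+1 :> nat)%:Z - (i.+1 == n)%:Z).

(** The left-hand side is the image of the dimension vector of P_i, whose support
    is the set of vertices from i on. *)
Lemma coxeter_sum (i : 'I_n) (j : 'I_n) :
  \sum_(a < n | (i <= a)%N) coxeter a j = - ((j <= i)%N)%:Z.
Proof.
have n0 : (0 < n)%N by case: (n) j => // -[].
under eq_bigr do rewrite mxE.
rewrite big_split /= (_ : - _ = (i < j)%N%:Z - 1); last by case: leqP.
congr (_ + _).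
  have [lt_ij|ge_ij] := ltnP i j.
    have hj : (j.-1 < n)%N by have := ltn_ord j; lia.
    rewrite (bigD1 (Ordinal hj)) /=; last by lia.
    rewrite big1 ?addr0 => [|a]; first by lia.
    by rewrite -val_eqE /=; lia.
  by rewrite big1 // => a; lia.
have hn : (n.-1 < n)%N by lia.
rewrite (bigD1 (Ordinal hn)) /=; last by have := ltn_ord i; lia.
rewrite big1 ?addr0 => [|a]; first by lia.
by rewrite -val_eqE /=; lia.
Qed.

(** Both sides are additive on triangles and agree on the projectives. *)
Lemma dimv_tau X : dimv (tau X) = dimv X *m coxeter.
Proof.
have [n0|n0] := posnP n.
  by apply/rowP => j; have := ltn_ord j; rewrite {2}n0.
apply/eqP; rewrite -subr_eq0; apply/eqP.
pose L (Y : Db) := dimv (tau Y) - dimv Y *m coxeter.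
apply: (@additive_vanish_proj K n _ L _ X n0) => [Y Y' Y'' u v w huvw|i].
  have [phi /(_ _ _ _ _ _ _ huvw) /dimv_additive e] := tau_exact tau.
  by rewrite /L e (dimv_additive huvw) mulmxDl opprD addrACA.
apply/eqP; rewrite subr_eq0; apply/eqP/rowP => j.
rewrite dimv_tau_proj mxE -(coxeter_sum i j) big_mkcond; apply: eq_bigr => a _.
by rewrite dimv_proj; case: leqP; rewrite ?mul1r ?mul0r.
Qed.

End Euler.

(** * Cyclicity of the Coxeter transformation *)
Section Coxeter.
Variables (n : nat) (n_gt0 : (0 < n)%N).
Let T (v : 'rV[int]_n) := v *m coxeter n.
Let i0 := Ordinal n_gt0.
Let e (i : 'I_n) : 'rV[int]_n := delta_mx 0 i.

Lemma coxeter_next (i i' : 'I_n) : i' = i.+1 :> nat -> T (e i) = e i'.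
Proof.
move=> ii'; apply/rowP => j; rewrite /T /e -rowE !mxE /= -val_eqE /= ii'.
by have := ltn_ord i'; rewrite ii'; lia.
Qed.

Lemma coxeter_last (i : 'I_n) : i.+1 = n -> T (e i) = - const_mx 1.
Proof.
move=> hi; apply/rowP => j; rewrite /T /e -rowE !mxE hi eqxx.
by have := ltn_ord j; lia.
Qed.

Lemma coxeter_const : T (- const_mx 1) = e i0.
Proof.
apply/rowP => j; rewrite /T mulNmx !mxE.
have := coxeter_sum i0 j; rewrite (eq_bigl xpredT) // => h.
under eq_bigr do rewrite mxE mul1r.
by rewrite h opprK eqxx -val_eqE /= leqn0; case: eqP.
Qed.

Lemma iter_coxeter_first (i : 'I_n) : iter i T (e i0) = e i.
Proof.
case: i => m; elim: m => [|m IH] h /=; first by congr e; exact: val_inj.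
by rewrite (IH (ltnW h)); exact: coxeter_next.
Qed.

Lemma iter_coxeter_mul k v : iter k T v = v *m iter k (mulmx^~ (coxeter n)) 1%:M.
Proof. by elim: k => [|k /= ->]; rewrite ?mulmx1 // /T mulmxA. Qed.

(** The orbit of e_0 is e_0, ..., e_(n-1), -(e_0 + ... + e_(n-1)), e_0, and it
    contains a basis. *)
Lemma iter_coxeter_period v : iter n.+1 T v = v.
Proof.
have h0 : iter n.+1 T (e i0) = e i0.
  have hl : (n.-1 < n)%N by lia.
  have -> : n.+1 = n.-1.+2 by lia.
  rewrite 2!iterS (iter_coxeter_first (Ordinal hl)).
  by rewrite coxeter_last ?coxeter_const //=; lia.
have hi i : iter n.+1 T (e i) = e i.
  by rewrite -{1}(iter_coxeter_first i) -iterD addnC iterD h0 iter_coxeter_first.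
rewrite [in RHS](row_sum_delta v) [in LHS](row_sum_delta v) iter_coxeter_mul mulmx_suml.
by apply: eq_bigr => i _; rewrite -scalemxAl -iter_coxeter_mul hi.
Qed.

Lemma iter_coxeter_mod k r v : iter (k * n.+1 + r) T v = iter r T v.
Proof.
rewrite addnC iterD; congr (iter r T _).
by elim: k => [//|k IH]; rewrite mulSn iterD IH iter_coxeter_period.
Qed.

(** The values l (e_i) alternate in sign, so their sum vanishes for even n; this
    sum is also l (e_(n-1)), because the transformation sends e_(n-1) to
    -(e_0 + ... + e_(n-1)). *)
Lemma coxeter_antiinvariant (G : zmodType) (l : {additive 'rV[int]_n -> G}) :
  ~~ odd n -> (forall v, l (T v) = - l v) -> forall v, l v = 0.
Proof.
move=> n_even lT.
have le (i : 'I_n) : l (e i) = l (e i0) *~ (-1) ^+ i.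
  rewrite -(iter_coxeter_first i); elim: (nat_of_ord i) => [|k IH] /=;
    first by rewrite mulr1z.
  by rewrite lT IH exprS mulN1r mulrNz.
have hl : (n.-1 < n)%N by lia.
have const_e : const_mx 1 = \sum_i e i.
  by rewrite [LHS]row_sum_delta; apply: eq_bigr => i _; rewrite mxE scale1r.
have sum0 : \sum_(i < n) (-1) ^+ i = 0 :> int.
  rewrite -(odd_double_half n) (negPf n_even) add0n.
  elim: (n./2) => [|m IH]; first by rewrite big_ord0.
  by rewrite doubleS !big_ord_recr /= IH add0r exprS mulN1r subrr.
have l_last : l (e (Ordinal hl)) = 0.
  apply: oppr_inj; rewrite -lT coxeter_last /=; last by lia.
  rewrite const_e raddfN raddf_sum /=; under eq_bigr do rewrite le.
  by rewrite -mulrz_sumr sum0 mulr0z oppr0.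
have l0 : l (e i0) = 0.
  have := le (Ordinal hl); rewrite l_last -signr_odd.
  by case: (odd _); rewrite ?expr0 ?expr1 ?mulrNz ?mulr1z => // /esym/eqP;
    rewrite oppr_eq0 => /eqP.
move=> v; rewrite (row_sum_delta v) raddf_sum big1 // => i _.
by rewrite -[v 0 i]intz scaler_int raddfMz /= le l0 mul0rz mul0rz.
Qed.

End Coxeter.

(** * An object and its first power in the orbit category *)
Section Orbit.
Variables (K : fieldType) (C : linCat K) (F : functor C C) (T : zpowers F).

Definition osingle_fun (X Y : C) d (f : hom X (T d Y)) (k : int) : hom X (T k Y) :=
  match d =P k with
  | ReflectT e => eq_rect d (fun k => hom X (T k Y)) f k e
  | ReflectF _ => 0
  end.

Lemma osingle_same X Y d (f : hom X (T d Y)) : osingle_fun f d = f.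
Proof. by rewrite /osingle_fun; case: eqP => // e; rewrite (eq_axiomK e). Qed.

Lemma osingle_diff X Y d (f : hom X (T d Y)) k : k != d -> osingle_fun f k = 0.
Proof. by rewrite /osingle_fun eq_sym; case: eqP. Qed.

(** A morphism of the orbit category concentrated in degree d. *)
Program Definition osingle (X Y : C) d (f : hom X (T d Y)) : ohom T X Y :=
  @DirSum K _ (osingle_fun f) _.
Next Obligation.
move=> X Y d f; apply: (@sub_finite_set _ _ [set d]%classic); last exact: finite_set1.
by move=> k /=; have [//|/osingle_diff ->] := eqVneq k d; rewrite eqxx.
Qed.

Lemma osingle0 X Y (f : hom X Y) : oinj T f = osingle (pw_eta T Y \c f).
Proof.
apply: dirsum_eq => k /=; have [->|k0] := eqVneq k 0.
  by rewrite oinj_fun0 osingle_same.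
by rewrite oinj_funN0 // osingle_diff.
Qed.

Lemma osingle_comp X Y Z d d' k (h : d + d' = k) (g : hom Y (T d' Z)) (f : hom X (T d Y)) :
  ocomp (osingle g) (osingle f) = osingle (pw_mu T h Z \c fmap (T d) g \c f).
Proof.
apply: dirsum_eq => m; rewrite (@ocomp_single _ _ _ _ _ _ _ _ _ _ d) => [|i id]; last first.
  by rewrite /oterm /= (osingle_diff f id) compm0.
rewrite /oterm /= osingle_same; have [mk|mk] := eqVneq m k; last first.
  have md : m - d != d' by lia.
  by rewrite (osingle_diff _ mk) (osingle_diff _ md) linear0 compm0 comp0m.
subst m; rewrite osingle_same; subst k.
have e : d + d' - d = d' by rewrite addrC addKr.
move: (subrKC d (d + d')); rewrite e => h'.
by rewrite osingle_same (eq_irrelevance h' erefl).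
Qed.

(** The identity of F X, placed in degree 1, is a morphism from F X to X; its
    inverse is the canonical map from X to F^-1 (F X), placed in degree -1. *)
Lemma orbit_power_iso X : exists f : hom (T 1 X : orbit_cat T) (X : orbit_cat T), is_iso f.
Proof.
have hm : -1 + 1 = 0 :> int by [].
have hp : 1 + -1 = 0 :> int by [].
have [m' [m'm mm']] := nt_iso (pw_mu T hm) X.
pose v0 : hom X (T (-1) (T 1 X)) := m' \c pw_eta T X.
exists (osingle (idm (T 1 X))), (osingle v0); split.
  rewrite /= (osingle_comp hp) osingle0 !compm1; congr osingle.
  have [a' [a'a _]] := nt_iso (pw_mu T (add0r (1 : int))) X.
  (* Compare after composing with the isomorphism F^0 F^1 -> F^1, so that *)
  (* associativity and the unit laws apply.                             *)
  rewrite -[LHS]comp1m -[RHS]comp1m -a'a -!compA; congr (_ \c _).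
  rewrite pw_etal compA (pw_assoc T hp (add0r 1) hm (addr0 1)) -compA -fmapM /v0.
  by rewrite compA mm' comp1m pw_etar.
rewrite /= (osingle_comp hm) osingle0 fmap1 !compm1; congr osingle.
by rewrite /v0 compA mm' comp1m.
Qed.

End Orbit.

(** * Vanishing of the Grothendieck group *)
Section K0.
Variables (K : fieldType) (C : linCat K) (t : tri_data C).

Definition K0cls (X : C) : K0 t := \pi_(K0 t)%qT (cls X).

Lemma K0_pi_rel x : K0_relator t x -> \pi_(K0 t)%qT x = 0.
Proof.
move=> hx; have <- : \pi_(K0 t)%qT (0 : FreeOb C) = 0 by rewrite raddf0.
apply/eqP; rewrite -Quotient.idealrBE subr0; apply/asboolP; exact: K0_span_rel.
Qed.

Lemma K0cls_iso (X Y : C) (f : hom X Y) : is_iso f -> K0cls X = K0cls Y.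
Proof. by move=> /K0_rel_iso - /(_ t) /K0_pi_rel; rewrite raddfB => /eqP;
  rewrite subr_eq0 => /eqP. Qed.

Lemma K0cls_additive : tri_additive t K0cls.
Proof.
move=> X Y Z u v w /K0_rel_tri /K0_pi_rel; rewrite raddfD raddfB => /eqP.
by rewrite addrAC subr_eq0 => /eqP.
Qed.

Lemma K0_generated : (forall X, K0cls X = 0) -> forall x : K0 t, x = 0.
Proof.
move=> h x; rewrite -[x]reprK; elim/freeg_ind_dom0: (repr x) => [|c X D _ _ IH].
  by rewrite raddf0.
rewrite raddfD /= IH addr0.
have -> : << c *g X >> = (cls X : FreeOb C) *~ c.
  by rewrite /cls freegU_mulz intz.
by rewrite raddfMz /= [X in X *~ _](h X) mul0rz.
Qed.

End K0.

Section Combination.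
Variables (n : nat) (G : zmodType) (s : 'I_n -> G).

Definition combination (v : 'rV[int]_n) : G := \sum_i s i *~ v 0 i.

Fact combination_is_zmod_morphism : zmod_morphism combination.
Proof.
move=> u v; rewrite /combination -sumrB; apply: eq_bigr => i _.
by rewrite !mxE mulrzBr.
Qed.
HB.instance Definition _ :=
  GRing.isZmodMorphism.Build 'rV[int]_n G combination combination_is_zmod_morphism.

Lemma combination_delta i : combination (delta_mx 0 i) = s i.
Proof.
rewrite /combination (bigD1 i) //= big1 => [|j /negPf ji]; rewrite !mxE !eqxx ?ji.
  by rewrite addr0 mulr1z.
by rewrite mulr0z.
Qed.

End Combination.

Section Main.
Variables (K : fieldType) (n : nat).
Local Notation Db := (Db K n).
Local Notation Db_tri := (Db_tri K n).

(** The difference of the two sides is additive and vanishes on the simples. *)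
Lemma additive_dimv (G : zmodType) (L : Db -> G) X : (0 < n)%N ->
  tri_additive Db_tri L -> L X = combination (fun i => L (simple_stalk K 0 i)) (dimv X).
Proof.
move=> n0 L_add; apply/eqP; rewrite -subr_eq0; apply/eqP.
set s := fun i => _; pose L' (Y : Db) := L Y - combination s (dimv Y).
apply: (@additive_vanish_simple K n _ L' _ X n0) => [Y Y' Y'' u v w h|i].
  by rewrite /L' (L_add _ _ _ _ _ _ h) (dimv_additive h) raddfD opprD addrACA.
by rewrite /L' dimv_simple combination_delta subrr.
Qed.

Variable tau : ar_translation Db_tri.
Let T (v : 'rV[int]_n) := v *m coxeter n.

Lemma dimv_tau_inv_susp X : T (dimv (fcomp (ae_inv tau) (susp Db_tri) X)) = - dimv X.
Proof.
rewrite /T -(dimv_tau tau) -dimv_shift.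
exact: dimv_iso (nt_iso (ae_counit tau) (cshift X)).
Qed.

(** The action of tau is moved to the left-hand side, so that only the action
    of tau itself has to be known. *)
Lemma dimv_rcc p X : iter p T (dimv (rcc_functor p tau X)) = (-1) ^+ p *: dimv X.
Proof.
elim: p => [|p IH]; first by rewrite scale1r.
by rewrite iterSr [X in iter p T X]dimv_tau_inv_susp iter_coxeter_mul mulNmx
  -iter_coxeter_mul IH exprS mulN1r scaleNr.
Qed.

End Main.

(** The residue of p modulo n + 1, in a form in which the exponent of the
    transformation is a natural number: -1 is written as n. *)
Lemma period_cases (n p : nat) : (1 <= p)%N ->
  (p%:Z = 1 %[mod (2 * n.+1)%:Z])%Z \/ (p%:Z = -1 %[mod (2 * n.+1)%:Z])%Z ->
  odd p /\ exists q, (p = q * n.+1 + 1 \/ p = q * n.+1 + n)%N.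
Proof.
move=> p_ge1 [] /eqP; rewrite eqz_mod_dvd => /dvdzP [c hc].
  have [m cm] : exists m : nat, c = m%:Z by exists `|c|%N; nia.
  have pE : p = (m * (2 * n.+1) + 1)%N by move: hc; rewrite cm; lia.
  split; first by rewrite pE addn1 /= mulnCA oddM.
  by exists (m * 2)%N; left; rewrite pE mulnA.
have [m cm] : exists m : nat, c = m.+1%:Z by exists `|c|.-1%N; nia.
have pE : p = ((m * 2 + 1) * n.+1 + n)%N by move: hc; rewrite cm; nia.
split; last by exists (m * 2 + 1)%N; right.
have /(congr1 odd) : p.+1 = (2 * (m.+1 * n.+1))%N by nia.
by rewrite oddM /=; case: odd.
Qed.

Theorem lemma3p14 (K : closedFieldType) (n p : nat)
  (n_ge2 : (2 <= n)%N) (n_even : ~~ odd n) (p_ge1 : (1 <= p)%N)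
  (p_mod : (p%:Z = 1 %[mod (2 * n.+1)%:Z])%Z \/ (p%:Z = -1 %[mod (2 * n.+1)%:Z])%Z)
  (tau : ar_translation (Db_tri K n))
  (P : zpowers (rcc_functor p tau))
  (tC : tri_data (orbit_cat P)) (tC_tri : triangulated tC)
  (proj_exact : triangle_functor (Db_tri K n) tC (orbit_proj P)) :
  forall x : K0 tC, x = 0.
Proof.
have n_gt0 : (0 < n)%N by lia.
pose T (v : 'rV[int]_n) := v *m coxeter n.
pose cl (X : Db K n) : K0 tC := K0cls tC X.
have cl_add : tri_additive (Db_tri K n) cl.
  move=> X Y Z u v w; case: proj_exact => phi H /H; exact: K0cls_additive.
have cl_F (X : Db K n) : cl (rcc_functor p tau X) = cl X.
  have [f /K0cls_iso fi] := orbit_power_iso P X; rewrite /cl -(fi tC).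
  have /(is_iso_fmap (orbit_proj P)) /K0cls_iso hi := nt_iso (pw_one P) X.
  by rewrite -(hi tC).
pose l : {additive 'rV[int]_n -> K0 tC} := combination (fun i => cl (simple_stalk K 0 i)).
have clE X : cl X = l (dimv X) by exact: additive_dimv.
have [p_odd [q p_eq]] := period_cases p_ge1 p_mod.
(* Identities linear in v need only be checked on the basis e_i = dimv S_i. *)
have l_ext (A : 'M[int]_n) : (forall X : Db K n, l (dimv X *m A) = - l (dimv X)) ->
    forall v, l (v *m A) = - l v.
  move=> base v; have lE (B : 'M[int]_n) :
      l (v *m B) = \sum_i l (delta_mx 0 i *m B) *~ v 0 i.
    rewrite {1}(row_sum_delta v) mulmx_suml raddf_sum; apply: eq_bigr => i _ /=.
    by rewrite -scalemxAl -{1}[v 0 i]intz scaler_int raddfMz.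
  rewrite -{2}[v]mulmx1 !lE -sumrN; apply: eq_bigr => i _.
  by rewrite mulmx1 -(dimv_simple K) base mulNrz.
(* w is the dimension vector of the p-th power of tau^-1 Sigma at X. *)
have w_eq (X : Db K n) : exists w, iter p T w = - dimv X /\ l w = l (dimv X).
  exists (dimv (rcc_functor p tau X)); rewrite -!clE cl_F; split=> //.
  by rewrite dimv_rcc -signr_odd p_odd scaleN1r.
have iterN k v : iter k T (- v) = - iter k T v.
  by rewrite !iter_coxeter_mul mulNmx.
have key v : l (T v) = - l v.
  case: p_eq => p_eq; last first.
    apply: l_ext => X; have [w [h <-]] := w_eq X.
    rewrite p_eq (iter_coxeter_mod n_gt0) in h.
    by rewrite -[dimv X]opprK -h mulNmx raddfN -[_ *m _]/(iter n.+1 T w)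
      iter_coxeter_period.
  have key_n u : l (iter n T u) = - l u.
    rewrite iter_coxeter_mul; apply: l_ext => X; have [w [h <-]] := w_eq X.
    rewrite p_eq (iter_coxeter_mod n_gt0) in h.
    by rewrite -iter_coxeter_mul -[dimv X]opprK -h iterN raddfN -iterSr iter_coxeter_period.
  by apply: oppr_inj; rewrite opprK -key_n -iterSr iter_coxeter_period.
apply: K0_generated => X; rewrite -/(cl X) clE.
exact: (coxeter_antiinvariant n_gt0).
Qed.
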